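(* Let $\mathcal{C}$ be a braided strict monoidal category with braiding $\beta$. Then the strict monoidal category $\mathrm{Aff}(\mathcal{C})$ (the affinization of $\mathcal{C}$) is isomorphic to the strict monoidal category obtained from $\mathcal{C}$ by adjoining (as monoidal generators) invertible morphisms $\xi_X\colon X\to X$ for all objects $X$ of $\mathcal{C}$, subject to the relations $$\beta_{Y,X}^{-1}\circ(\xi_X\otimes 1_Y)=(1_Y\otimes \xi_X)\circ\beta_{X,Y},\qquad \xi_{X\otimes Y}=\xi_X\otimes\xi_Y,\qquad \xi_Y\circ f=f\circ\xi_X,$$ where in the first two relations $X,Y$ range over all objects of $\mathcal{C}$ and in the third $f\colon X\to Y$ ranges over all morphisms of $\mathcal{C}$.
   Context: All categories are essentially small. $\mathbf{1}$ denotes the unit object of a monoidal category and $1_X$ the identity morphism of $X$. Affinization: for a strict monoidal category $\mathcal{C}$, $\mathrm{Aff}(\mathcal{C})$ is the category with the same objects as $\mathcal{C}$, obtained from $\mathcal{C}$ by adjoining (under composition) invertible morphisms $\xi_{X,Y}\colon X\otimes Y\to Y\otimes X$ for all objects $X,Y$, subject to $$\xi_{X,Y\otimes Z}=\xi_{Z\otimes X,Y}\circ\xi_{X\otimes Y,Z},\qquad \xi_{X_2,Y_2}\circ(g\otimes f)=(f\otimes g)\circ\xi_{X_1,Y_1}$$ for all objects $X,X_1,X_2,Y,Y_1,Y_2,Z$ and all $f\in\mathrm{Hom}_{\mathcal{C}}(Y_1,Y_2)$, $g\in\mathrm{Hom}_{\mathcal{C}}(X_1,X_2)$. Inside $\mathrm{Aff}(\mathcal{C})$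 one writes $\xi_X:=\xi_{\mathbf{1},X}$. Braiding convention: a braiding is a natural family of isomorphisms $\beta_{X,Y}\colon X\otimes Y\to Y\otimes X$ with $\beta_{X,Y\otimes Z}=(1_Y\otimes\beta_{X,Z})\circ(\beta_{X,Y}\otimes 1_Z)$ and $\beta_{X\otimes Y,Z}=(\beta_{X,Z}\otimes 1_Y)\circ(1_X\otimes\beta_{Y,Z})$. Monoidal structure: if $\mathcal{C}$ is braided, $\mathrm{Aff}(\mathcal{C})$ is viewed as a strict monoidal category with the unique tensor product extending that of $\mathcal{C}$ such that $\xi_{X,Y}\otimes 1_Z=\xi_{X\otimes Z,Y}\circ(1_X\otimes\beta_{Y,Z})$ and $1_X\otimes\xi_{Y,Z}=(\beta_{X,Z}^{-1}\otimes 1_Y)\circ\xi_{X\otimes Y,Z}$ for all objects $X,Y,Z$. *)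

(* Defs.v *)
From mathcomp Require Import all_boot generic_quotient.
From mathcomp Require Import boolp.

Set Implicit Arguments.
Unset Strict Implicit.
Unset Printing Implicit Defensive.

Declare Scope cat_scope.
Delimit Scope cat_scope with cat.
Local Open Scope cat_scope.

Reserved Notation "g ∘ f" (at level 40, left associativity).
Reserved Notation "X ⊗ Y" (at level 38, left associativity).
Reserved Notation "f ⊠ g" (at level 38, left associativity).

Record Category := MkCategory {
  Ob :> Type;
  Hom : Ob -> Ob -> Type;
  idm : forall X, Hom X X;
  comp : forall X Y Z, Hom Y Z -> Hom X Y -> Hom X Z;
  compA : forall X Y Z W (h : Hom Z W) (g : Hom Y Z) (f : Hom X Y),
    comp h (comp g f) = comp (comp h g) f;
  comp1f : forall X Y (f : Hom X Y), comp (idm Y) f = f;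
  compf1 : forall X Y (f : Hom X Y), comp f (idm X) = f
}.
Arguments Hom {c} X Y.
Arguments idm {c} X.
Arguments comp {c X Y Z} g f.
Notation "g ∘ f" := (comp g f) : cat_scope.

(* The identity morphism, seen as a morphism between propositionally equal
   objects: strict associativity and unitality make X ⊗ (Y ⊗ Z) and
   (X ⊗ Y) ⊗ Z equal, but not convertible, so morphisms between them are
   compared up to composition with idto. *)
Definition idto (C : Category) (X Y : C) (e : X = Y) : Hom X Y :=
  match e in _ = Y' return Hom X Y' with erefl => idm X end.
Arguments idto {C X Y} e.

Record Functor (C D : Category) := MkFunctor {
  fO :> C -> D;
  fH : forall X Y : C, Hom X Y -> Hom (fO X) (fO Y);
  fH1 : forall X : C, fH (idm X) = idm (fO X);
  fHM : forall (X Y Z : C) (g : Hom Y Z) (f : Hom X Y), fH (g ∘ f) = fH g ∘ fH f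
}.
Arguments fH {C D} F {X Y} _ : rename.

Definition idF (C : Category) : Functor C C :=
  @MkFunctor C C id (fun _ _ => id) (fun _ => erefl) (fun _ _ _ _ _ => erefl).

Definition compF (C D E : Category) (G : Functor D E) (F : Functor C D) :
  Functor C E.
Proof.
exists (fun X => G (F X)) (fun X Y f => fH G (fH F f)).
- by move=> X; rewrite !fH1.
- by move=> X Y Z g f; rewrite !fHM.
Defined.

(* Leibniz equality of functors, with the transport along e made explicit. *)
Definition eqF (C D : Category) (F G : Functor C D) : Prop :=
  exists e : forall X, F X = G X,
    forall (X Y : C) (f : Hom X Y), idto (e Y) ∘ fH F f = fH G f ∘ idto (e X).

Record StrictMonoidal := MkStrictMonoidal {
  smCat :> Category;
  unitO : smCat;
  tensO : smCat -> smCat -> smCat;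
  tensH : forall X X' Y Y' : smCat,
    Hom X X' -> Hom Y Y' -> Hom (tensO X Y) (tensO X' Y');
  tensOA : forall X Y Z, tensO X (tensO Y Z) = tensO (tensO X Y) Z;
  tens1O : forall X, tensO unitO X = X;
  tensO1 : forall X, tensO X unitO = X;
  tensH1 : forall X Y, tensH (idm X) (idm Y) = idm (tensO X Y);
  tensHM : forall (X X' X'' Y Y' Y'' : smCat)
      (f' : Hom X' X'') (f : Hom X X') (g' : Hom Y' Y'') (g : Hom Y Y'),
    tensH (f' ∘ f) (g' ∘ g) = tensH f' g' ∘ tensH f g;
  tensHA : forall (X X' Y Y' Z Z' : smCat)
      (f : Hom X X') (g : Hom Y Y') (h : Hom Z Z'),
    idto (tensOA X' Y' Z') ∘ tensH f (tensH g h)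
    = tensH (tensH f g) h ∘ idto (tensOA X Y Z);
  tens1H : forall (X Y : smCat) (f : Hom X Y),
    idto (tens1O Y) ∘ tensH (idm unitO) f = f ∘ idto (tens1O X);
  tensH1r : forall (X Y : smCat) (f : Hom X Y),
    idto (tensO1 Y) ∘ tensH f (idm unitO) = f ∘ idto (tensO1 X)
}.
Arguments unitO {s}.
Arguments tensO {s} X Y.
Arguments tensH {s X X' Y Y'} f g.
Notation "𝟏" := unitO : cat_scope.
Notation "X ⊗ Y" := (tensO X Y) : cat_scope.
Notation "f ⊠ g" := (tensH f g) : cat_scope.

(* The associator and its inverse; both are identity morphisms. *)
Definition asc (C : StrictMonoidal) (X Y Z : C) :
  Hom (X ⊗ (Y ⊗ Z)) ((X ⊗ Y) ⊗ Z) := idto (tensOA X Y Z).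
Definition ascV (C : StrictMonoidal) (X Y Z : C) :
  Hom ((X ⊗ Y) ⊗ Z) (X ⊗ (Y ⊗ Z)) := idto (esym (tensOA X Y Z)).
Arguments asc {C} X Y Z.
Arguments ascV {C} X Y Z.

Record SMFunctor (C D : StrictMonoidal) := MkSMFunctor {
  smF :> Functor C D;
  smF1 : smF 𝟏 = 𝟏;
  smFO : forall X Y : C, smF (X ⊗ Y) = smF X ⊗ smF Y;
  smFH : forall (X X' Y Y' : C) (f : Hom X X') (g : Hom Y Y'),
    idto (smFO X' Y') ∘ fH smF (f ⊠ g) = (fH smF f ⊠ fH smF g) ∘ idto (smFO X Y)
}.

Definition isoSM (C D : StrictMonoidal) : Prop :=
  exists (F : SMFunctor C D) (G : SMFunctor D C),
    eqF (compF G F) (idF C) /\ eqF (compF F G) (idF D).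

Record BraidedStrictMonoidal := MkBraided {
  brSM :> StrictMonoidal;
  braid : forall X Y : brSM, Hom (X ⊗ Y) (Y ⊗ X);
  braidV : forall X Y : brSM, Hom (Y ⊗ X) (X ⊗ Y);
  braidK : forall X Y, braidV X Y ∘ braid X Y = idm (X ⊗ Y);
  braidVK : forall X Y, braid X Y ∘ braidV X Y = idm (Y ⊗ X);
  braid_nat : forall (X X' Y Y' : brSM) (f : Hom X X') (g : Hom Y Y'),
    braid X' Y' ∘ (f ⊠ g) = (g ⊠ f) ∘ braid X Y;
  braid_hexr : forall X Y Z : brSM,
    braid X (Y ⊗ Z)
    = asc Y Z X ∘ (idm Y ⊠ braid X Z) ∘ ascV Y X Z ∘ (braid X Y ⊠ idm Z)
      ∘ asc X Y Z;
  braid_hexl : forall X Y Z : brSM,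
    braid (X ⊗ Y) Z
    = ascV Z X Y ∘ (braid X Z ⊠ idm Y) ∘ asc X Z Y ∘ (idm X ⊠ braid Y Z)
      ∘ ascV X Y Z
}.
Arguments braid {b} X Y.
Arguments braidV {b} X Y.

Section Quotient.
Variables (T : Type) (R : T -> T -> Prop).
Hypotheses (Rrefl : forall x, R x x) (Rsym : forall x y, R x y -> R y x)
  (Rtrans : forall x y z, R x y -> R y z -> R x z).

Let r : rel {classic T} := fun x y => `[< R x y >].
Let r_refl : reflexive r. Proof. by move=> x; apply/asboolP. Qed.
Let r_sym : symmetric r.
Proof. by move=> x y; apply/asboolP/asboolP; apply: Rsym. Qed.
Let r_trans : transitive r.
Proof. by move=> y x z /asboolP xy /asboolP yz; apply/asboolP; apply: Rtrans yz. Qed.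

Definition equiv_of : equiv_rel {classic T} := EquivRel r r_refl r_sym r_trans.
Definition quot : Type := {eq_quot equiv_of}%qT.
Definition qpi (x : T) : quot := (\pi_({eq_quot equiv_of}%qT) (x : {classic T}))%qT.
Definition qrepr (q : quot) : T := repr (q : {eq_quot equiv_of}%qT).

Lemma qreprK q : qpi (qrepr q) = q. Proof. exact: reprK. Qed.
Lemma qpiE x y : R x y -> qpi x = qpi y.
Proof. by move=> xy; apply/eqmodP/asboolP. Qed.
Lemma qpiP x y : qpi x = qpi y -> R x y.
Proof. by move/eqmodP/asboolP. Qed.
Lemma qreprP x : R (qrepr (qpi x)) x.
Proof. by apply: qpiP; rewrite qreprK. Qed.
End Quotient.

(* Formal composites of morphisms of C, of the ξ_{X,Y} and of their inverses. *)
Inductive affTerm (C : StrictMonoidal) : C -> C -> Type :=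
| aIn X Y (f : Hom X Y) : affTerm X Y
| aXi X Y : affTerm (X ⊗ Y) (Y ⊗ X)
| aXiV X Y : affTerm (Y ⊗ X) (X ⊗ Y)
| aComp X Y Z (t : affTerm Y Z) (s : affTerm X Y) : affTerm X Z.
Arguments aIn {C X Y} f.
Arguments aXi {C} X Y.
Arguments aXiV {C} X Y.
Arguments aComp {C X Y Z} t s.

(* The least congruence that makes the formal composites a category, aIn a
   functor and ξ invertible, and that contains the two defining relations. *)
Inductive affEq (C : StrictMonoidal) :
    forall X Y : C, affTerm X Y -> affTerm X Y -> Prop :=
| ae_refl X Y (t : affTerm X Y) : affEq t t
| ae_sym X Y (t s : affTerm X Y) : affEq t s -> affEq s t
| ae_trans X Y (t s u : affTerm X Y) : affEq t s -> affEq s u -> affEq t u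
| ae_comp X Y Z (t t' : affTerm Y Z) (s s' : affTerm X Y) :
    affEq t t' -> affEq s s' -> affEq (aComp t s) (aComp t' s')
| ae_assoc X Y Z W (u : affTerm Z W) (t : affTerm Y Z) (s : affTerm X Y) :
    affEq (aComp u (aComp t s)) (aComp (aComp u t) s)
| ae_idl X Y (t : affTerm X Y) : affEq (aComp (aIn (idm Y)) t) t
| ae_idr X Y (t : affTerm X Y) : affEq (aComp t (aIn (idm X))) t
| ae_in X Y Z (g : Hom Y Z) (f : Hom X Y) :
    affEq (aIn (g ∘ f)) (aComp (aIn g) (aIn f))
| ae_xiK (X Y : C) : affEq (aComp (aXiV X Y) (aXi X Y)) (aIn (idm (X ⊗ Y)))
| ae_xiVK (X Y : C) : affEq (aComp (aXi X Y) (aXiV X Y)) (aIn (idm (Y ⊗ X)))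
| ae_xi_tens (X Y Z : C) :
    affEq (aXi X (Y ⊗ Z))
      (aComp (aIn (asc Y Z X)) (aComp (aXi (Z ⊗ X) Y)
        (aComp (aIn (asc Z X Y)) (aComp (aXi (X ⊗ Y) Z) (aIn (asc X Y Z))))))
| ae_xi_nat (X1 X2 Y1 Y2 : C) (f : Hom Y1 Y2) (g : Hom X1 X2) :
    affEq (aComp (aXi X2 Y2) (aIn (g ⊠ f))) (aComp (aIn (f ⊠ g)) (aXi X1 Y1)).

Section AffCat.
Variable C : StrictMonoidal.

Definition affHom (X Y : C) : Type :=
  quot (@ae_refl C X Y) (@ae_sym C X Y) (@ae_trans C X Y).
Definition affPi (X Y : C) (t : affTerm X Y) : affHom X Y := qpi _ _ _ t.
Definition affRepr (X Y : C) (f : affHom X Y) : affTerm X Y := qrepr f.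
Definition affComp (X Y Z : C) (g : affHom Y Z) (f : affHom X Y) : affHom X Z :=
  affPi (aComp (affRepr g) (affRepr f)).

Lemma affPiE (X Y : C) (t s : affTerm X Y) : affEq t s -> affPi t = affPi s.
Proof. exact: qpiE. Qed.
Lemma affReprK (X Y : C) (f : affHom X Y) : affPi (affRepr f) = f.
Proof. exact: qreprK. Qed.
Lemma affReprP (X Y : C) (t : affTerm X Y) : affEq (affRepr (affPi t)) t.
Proof. exact: qreprP. Qed.
Lemma affCompE (X Y Z : C) (t : affTerm Y Z) (s : affTerm X Y) :
  affComp (affPi t) (affPi s) = affPi (aComp t s).
Proof. by apply: affPiE; apply: ae_comp; apply: affReprP. Qed.

Definition AffCat : Category.
Proof.
refine (@MkCategory C affHom (fun X => affPi (aIn (idm X))) affComp _ _ _).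
- move=> X Y Z W h g f; rewrite -(affReprK h) -(affReprK g) -(affReprK f).
  by rewrite !affCompE; apply: affPiE; apply: ae_assoc.
- by move=> X Y f; rewrite -(affReprK f) affCompE; apply: affPiE; apply: ae_idl.
- by move=> X Y f; rewrite -(affReprK f) affCompE; apply: affPiE; apply: ae_idr.
Defined.

Definition affIn : Functor C AffCat.
Proof.
refine (@MkFunctor C AffCat id (fun X Y f => affPi (aIn f)) (fun _ => erefl) _).
by move=> X Y Z g f /=; rewrite affCompE; apply: affPiE; apply: ae_in.
Defined.

Definition affXi (X Y : C) : @Hom AffCat (X ⊗ Y) (Y ⊗ X) := affPi (aXi X Y).
Definition affXiV (X Y : C) : @Hom AffCat (Y ⊗ X) (X ⊗ Y) := affPi (aXiV X Y).

Lemma affXiK X Y : affXiV X Y ∘ affXi X Y = idm (X ⊗ Y : AffCat).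
Proof. by rewrite /= affCompE; apply: affPiE; apply: ae_xiK. Qed.
Lemma affXiVK X Y : affXi X Y ∘ affXiV X Y = idm (Y ⊗ X : AffCat).
Proof. by rewrite /= affCompE; apply: affPiE; apply: ae_xiVK. Qed.
Lemma affXi_tens X Y Z :
  affXi X (Y ⊗ Z)
  = fH affIn (asc Y Z X) ∘ (affXi (Z ⊗ X) Y ∘ (fH affIn (asc Z X Y) ∘
      (affXi (X ⊗ Y) Z ∘ fH affIn (asc X Y Z)))).
Proof. by rewrite /affXi /= !affCompE; apply: affPiE; apply: ae_xi_tens. Qed.
Lemma affXi_nat X1 X2 Y1 Y2 (f : Hom Y1 Y2) (g : Hom X1 X2) :
  affXi X2 Y2 ∘ fH affIn (g ⊠ f) = fH affIn (f ⊠ g) ∘ affXi X1 Y1.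
Proof. by rewrite /= !affCompE; apply: affPiE; apply: ae_xi_nat. Qed.

Section Lift.
Variables (D : Category) (F : Functor C D).
Variables (x : forall X Y : C, Hom (F (X ⊗ Y)) (F (Y ⊗ X)))
          (xV : forall X Y : C, Hom (F (Y ⊗ X)) (F (X ⊗ Y))).
Hypothesis xK : forall X Y, xV X Y ∘ x X Y = idm _.
Hypothesis xVK : forall X Y, x X Y ∘ xV X Y = idm _.
Hypothesis x_tens : forall X Y Z,
  x X (Y ⊗ Z) = fH F (asc Y Z X) ∘ (x (Z ⊗ X) Y ∘ (fH F (asc Z X Y) ∘
      (x (X ⊗ Y) Z ∘ fH F (asc X Y Z)))).
Hypothesis x_nat : forall X1 X2 Y1 Y2 (f : Hom Y1 Y2) (g : Hom X1 X2),
  x X2 Y2 ∘ fH F (g ⊠ f) = fH F (f ⊠ g) ∘ x X1 Y1.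

Fixpoint affEval (X Y : C) (t : affTerm X Y) : Hom (F X) (F Y) :=
  match t in affTerm X Y return Hom (F X) (F Y) with
  | aIn X Y f => fH F f
  | aXi X Y => x X Y
  | aXiV X Y => xV X Y
  | aComp X Y Z t s => affEval t ∘ affEval s
  end.

Lemma affEvalE X Y (t s : affTerm X Y) : affEq t s -> affEval t = affEval s.
Proof.
elim=> {X Y t s} //=.
- by move=> X Y t s u _ -> _ ->.
- by move=> X Y Z t t' s s' _ -> _ ->.
- by move=> *; rewrite compA.
- by move=> *; rewrite fH1 comp1f.
- by move=> *; rewrite fH1 compf1.
- by move=> *; rewrite fHM.
- by move=> X Y; rewrite fH1.
- by move=> X Y; rewrite fH1.
Qed.

Definition affLift : Functor AffCat D.
Proof.
refine (@MkFunctor AffCat D F (fun X Y f => affEval (affRepr f)) _ _).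
- by move=> X; rewrite (affEvalE (affReprP _)) /= fH1.
- by move=> X Y Z g f /=; rewrite (affEvalE (affReprP _)).
Defined.

Lemma affLift_in X Y (f : Hom X Y) : fH affLift (fH affIn f) = fH F f.
Proof. by rewrite /= (affEvalE (affReprP _)). Qed.
Lemma affLift_xi X Y : fH affLift (affXi X Y) = x X Y.
Proof. by rewrite /= (affEvalE (affReprP _)). Qed.
End Lift.

(* Naturality with respect to AffCat may be checked on generators. *)
Lemma affNat (D : Category) (F G : Functor AffCat D)
    (eta : forall X : C, Hom (F X) (G X)) :
  (forall X Y (f : @Hom C X Y),
     eta Y ∘ fH F (fH affIn f) = fH G (fH affIn f) ∘ eta X) ->
  (forall X Y : C,
     eta (Y ⊗ X) ∘ fH F (affXi X Y) = fH G (affXi X Y) ∘ eta (X ⊗ Y)) ->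
  forall (X Y : AffCat) (f : Hom X Y), eta Y ∘ fH F f = fH G f ∘ eta X.
Proof.
move=> nin nxi X Y f; rewrite -(affReprK f).
elim: {f}(affRepr f) => {X Y} [X Y f|X Y|X Y|X Y Z t IHt s IHs].
- exact: nin.
- exact: nxi.
- rewrite -/(affXiV X Y) -[LHS]comp1f -(fH1 G) -affXiK fHM -!compA.
  congr (_ ∘ _); rewrite compA -nxi -compA -fHM affXiVK fH1 compf1 //.
- rewrite -affCompE -[affComp _ _]/(comp (c := AffCat) (affPi t) (affPi s)).
  by rewrite !fHM compA IHt -compA IHs compA.
Qed.

End AffCat.

(* Arrows with their endpoints, and a totalized composition, None standing for
   non-composable.  On untyped arrows, strict associativity and unitality
   are plain equalities, which is how the proofs below get rid of idto. *)
Section Arrows.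
Variable C : Category.

Definition arr : Type := option {X : C & {Y : C & Hom X Y}}.
Definition pack (X Y : C) (f : Hom X Y) : arr := Some (existT _ X (existT _ Y f)).
Definition ai (X : C) : arr := pack (idm X).
Definition ac (b a : arr) : arr :=
  match b, a with
  | Some (existT Y' (existT Z g)), Some (existT X (existT Y f)) =>
      match pselect (Y = Y') with
      | left e => pack (g ∘ (idto e ∘ f))
      | right _ => None
      end
  | _, _ => None
  end.
Definition typed (a : arr) (X Y : C) : Prop := exists f : Hom X Y, a = pack f.

Lemma existT_inj (A : Type) (P : A -> Type) (x : A) (p q : P x) :
  existT P x p = existT P x q -> p = q.
Proof.
move=> E; have := projT2_eq E.
by rewrite (Prop_irrelevance (projT1_eq E) erefl).
Qed.

Lemma pack_inj (X Y : C) (f g : Hom X Y) : pack f = pack g -> f = g.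
Proof. by move=> /Some_inj E; apply: existT_inj (existT_inj E). Qed.

Lemma pack_idto (X Y : C) (e : X = Y) : pack (idto e) = ai X.
Proof. by case: Y / e. Qed.

Lemma pack_comp (X Y Z : C) (g : Hom Y Z) (f : Hom X Y) :
  pack (g ∘ f) = ac (pack g) (pack f).
Proof.
rewrite /= ; case: pselect => // e.
by rewrite (Prop_irrelevance e erefl) comp1f.
Qed.

Lemma acA c b a : ac c (ac b a) = ac (ac c b) a.
Proof.
case: b => [[Y [Z' g]]|]; last by case: c => [[Z [W h]]|].
case: c => [[Z [W h]]|]; last by case: a => [[X [Y' f]]|] //=; case: pselect.
case: a => [[X [Y' f]]|]; last by rewrite /=; case: pselect.
rewrite -!/(pack _) {2}/ac {3}/ac /=.
case: (pselect (Y' = Y)) => [e|ne]; case: (pselect (Z' = Z)) => [e'|ne'] //=.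
- case: Y / e g => g; case: Z / e' h => h.
  case: pselect => // e; case: pselect => // e'.
  by rewrite !(Prop_irrelevance e erefl) (Prop_irrelevance e' erefl) /= !comp1f compA.
- by case: pselect.
- by case: pselect.
Qed.

Lemma typed_pack (X Y : C) (f : Hom X Y) : typed (pack f) X Y.
Proof. by exists f. Qed.
Lemma typed_i X : typed (ai X) X X. Proof. exact: typed_pack. Qed.
Lemma typed_c b a X Y Y' Z :
  typed a X Y -> typed b Y' Z -> Y = Y' -> typed (ac b a) X Z.
Proof.
by move=> [f ->] [g ->] e; case: Y' / e g => g; rewrite -pack_comp; apply: typed_pack.
Qed.
Lemma typed_eq a X Y X' Y' : typed a X Y -> X = X' -> Y = Y' -> typed a X' Y'.
Proof. by move=> ? <- <-. Qed.

Lemma ac1a a X Y : typed a X Y -> ac (ai Y) a = a.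
Proof. by move=> [f ->]; rewrite -pack_comp comp1f. Qed.
Lemma aca1 a X Y : typed a X Y -> ac a (ai X) = a.
Proof. by move=> [f ->]; rewrite -pack_comp compf1. Qed.

Lemma idto_pack (X Y X' Y' : C) (f : Hom X Y) (g : Hom X' Y')
    (eX : X = X') (eY : Y = Y') :
  pack f = pack g -> idto eY ∘ f = g ∘ idto eX.
Proof.
move=> E; apply: pack_inj; rewrite !pack_comp !pack_idto E eX eY.
by rewrite (aca1 (typed_pack g)) (ac1a (typed_pack g)).
Qed.

Lemma pack_eq_idto (X Y X' Y' : C) (f : Hom X Y) (g : Hom X' Y')
    (eX : X = X') (eY : Y = Y') :
  idto eY ∘ f = g ∘ idto eX -> pack f = pack g.
Proof.
case: X' / eX g => g; case: Y' / eY g => g /=; rewrite comp1f compf1.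
by move=> ->.
Qed.
End Arrows.

Definition amap (C D : Category) (F : Functor C D) (a : arr C) : arr D :=
  match a with
  | Some (existT X (existT Y f)) => pack (fH F f)
  | None => None
  end.

Lemma amap_i (C D : Category) (F : Functor C D) X : amap F (ai X) = ai (F X).
Proof. by rewrite /= fH1. Qed.
Lemma amap_c (C D : Category) (F : Functor C D) (b a : arr C) X Y Z :
  typed a X Y -> typed b Y Z -> amap F (ac b a) = ac (amap F b) (amap F a).
Proof. by move=> [f ->] [g ->]; rewrite -pack_comp /amap /= fHM pack_comp. Qed.

Section TensorArrows.
Variable C : StrictMonoidal.

Definition at2 (a b : arr C) : arr C :=
  match a, b with
  | Some (existT X (existT Y f)), Some (existT X' (existT Y' g)) => pack (f ⊠ g)
  | _, _ => None
  end.

Lemma pack_tens (X X' Y Y' : C) (f : Hom X X') (g : Hom Y Y') :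
  pack (f ⊠ g) = at2 (pack f) (pack g).
Proof. by []. Qed.
Lemma at_i X Y : at2 (ai X) (ai Y) = ai (X ⊗ Y).
Proof. by rewrite /= tensH1. Qed.
Lemma atA a b c : at2 a (at2 b c) = at2 (at2 a b) c.
Proof.
case: a b c => [[X [X' f]]|] [[Y [Y' g]]|] [[Z [Z' h]]|] //=.
exact: pack_eq_idto (tensHA f g h).
Qed.
Lemma at1a a : at2 (ai 𝟏) a = a.
Proof. by case: a => [[X [Y f]]|] //; apply: pack_eq_idto (tens1H f). Qed.
Lemma ata1 a : at2 a (ai 𝟏) = a.
Proof. by case: a => [[X [Y f]]|] //; apply: pack_eq_idto (tensH1r f). Qed.
Lemma at_c f' f g' g (X X' X'' Y Y' Y'' : C) :
  typed f X X' -> typed f' X' X'' -> typed g Y Y' -> typed g' Y' Y'' ->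
  at2 (ac f' f) (ac g' g) = ac (at2 f' g') (at2 f g).
Proof.
move=> [{}f ->] [{}f' ->] [{}g ->] [{}g' ->].
by rewrite -!pack_comp /at2 /= tensHM pack_comp.
Qed.
Lemma typed_t a b (X X' Y Y' : C) :
  typed a X X' -> typed b Y Y' -> typed (at2 a b) (X ⊗ Y) (X' ⊗ Y').
Proof. by move=> [f ->] [g ->]; apply: typed_pack. Qed.
End TensorArrows.

Create HintDb typed_db.
#[local] Hint Resolve typed_pack typed_i : typed_db.
(* Solves typing goals, up to strict associativity and unitality. *)
Local Ltac ty :=
  lazymatch goal with
  | |- typed (ac _ _) _ _ => eapply typed_eq; [eapply typed_c; ty | ty | ty]
  | |- typed (at2 _ _) _ _ => eapply typed_eq; [eapply typed_t; ty | ty | ty]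
  | |- typed _ _ _ => eapply typed_eq; [eauto with typed_db nocore | ty | ty]
  | |- _ => try reflexivity; try (rewrite ?tensOA ?tens1O ?tensO1; reflexivity)
  end.

Section BraidedArrows.
Variable C : BraidedStrictMonoidal.
Implicit Types X Y Z W : C.

Definition ab X Y : arr C := pack (braid X Y).
Definition abv X Y : arr C := pack (braidV X Y).

Lemma typed_b X Y : typed (ab X Y) (X ⊗ Y) (Y ⊗ X).
Proof. exact: typed_pack. Qed.
Lemma typed_bv X Y : typed (abv X Y) (Y ⊗ X) (X ⊗ Y).
Proof. exact: typed_pack. Qed.
#[local] Hint Resolve typed_b typed_bv : typed_db.

Lemma abK X Y : ac (abv X Y) (ab X Y) = ai (X ⊗ Y).
Proof. by rewrite -pack_comp braidK. Qed.
Lemma abVK X Y : ac (ab X Y) (abv X Y) = ai (Y ⊗ X).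
Proof. by rewrite -pack_comp braidVK. Qed.

Lemma ab_nat f g X X' Y Y' : typed f X X' -> typed g Y Y' ->
  ac (ab X' Y') (at2 f g) = ac (at2 g f) (ab X Y).
Proof.
by move=> [{}f ->] [{}g ->]; rewrite -[LHS]pack_comp braid_nat pack_comp.
Qed.
Lemma abv_nat f g X X' Y Y' : typed f X X' -> typed g Y Y' ->
  ac (abv X' Y') (at2 g f) = ac (at2 f g) (abv X Y).
Proof.
move=> tf tg; rewrite -[at2 g f](@aca1 _ _ (Y ⊗ X) (Y' ⊗ X')); last by ty.
rewrite -abVK (acA (at2 g f)) -(ab_nat tf tg) !acA abK (@ac1a _ _ (X ⊗ Y)) //.
by ty.
Qed.

Lemma ab_hexr X Y Z :
  ab X (Y ⊗ Z) = ac (at2 (ai Y) (ab X Z)) (at2 (ab X Y) (ai Z)).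
Proof.
rewrite /ab braid_hexr !pack_comp !pack_idto !pack_tens.
rewrite -!/(ai _) -!/(ab _ _).
rewrite (@aca1 _ _ (X ⊗ (Y ⊗ Z)) ((Y ⊗ Z) ⊗ X)); last by ty.
rewrite (@ac1a _ (at2 _ _) (Y ⊗ (X ⊗ Z)) (Y ⊗ (Z ⊗ X))); last by ty.
rewrite (@aca1 _ _ ((Y ⊗ X) ⊗ Z) (Y ⊗ (Z ⊗ X))) //; by ty.
Qed.
Lemma ab_hexl X Y Z :
  ab (X ⊗ Y) Z = ac (at2 (ab X Z) (ai Y)) (at2 (ai X) (ab Y Z)).
Proof.
rewrite /ab braid_hexl !pack_comp !pack_idto !pack_tens.
rewrite -!/(ai _) -!/(ab _ _).
rewrite (@aca1 _ _ ((X ⊗ Y) ⊗ Z) (Z ⊗ (X ⊗ Y))); last by ty.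
rewrite (@ac1a _ (at2 _ _) (X ⊗ (Z ⊗ Y)) ((Z ⊗ X) ⊗ Y)); last by ty.
rewrite (@aca1 _ _ (X ⊗ (Z ⊗ Y)) ((Z ⊗ X) ⊗ Y)) //; by ty.
Qed.

(* Two-sided inverses of untyped arrows are unique. *)
Lemma ainv_uniq (D : Category) (a b c : arr D) (X Y : D) :
  typed b Y X -> typed c Y X -> ac b a = ai X -> ac a c = ai Y -> b = c.
Proof.
move=> tb tc ba ac1.
by rewrite -(aca1 tb) -ac1 acA ba (ac1a tc).
Qed.

Lemma abv_hexr X Y Z :
  abv X (Y ⊗ Z) = ac (at2 (abv X Y) (ai Z)) (at2 (ai Y) (abv X Z)).
Proof.
apply: (@ainv_uniq _ (ab X (Y ⊗ Z)) _ _ (X ⊗ (Y ⊗ Z)) ((Y ⊗ Z) ⊗ X)).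
- by ty.
- by ty.
- exact: abK.
rewrite ab_hexr -acA (acA (at2 (ab X Y) _)).
rewrite -(@at_c _ _ _ _ _ (Y ⊗ X) (X ⊗ Y) (Y ⊗ X) Z Z Z); try by ty.
rewrite abVK (@ac1a _ (ai Z) Z); last by ty.
rewrite at_i (@ac1a _ _ ((Y ⊗ Z) ⊗ X)); last by ty.
rewrite -(@at_c _ _ _ _ _ Y Y Y (Z ⊗ X) (X ⊗ Z) (Z ⊗ X)); try by ty.
by rewrite abVK (@ac1a _ (ai Y) Y) ?at_i ?tensOA //; ty.
Qed.
Lemma abv_hexl X Y Z :
  abv (X ⊗ Y) Z = ac (at2 (ai X) (abv Y Z)) (at2 (abv X Z) (ai Y)).
Proof.
apply: (@ainv_uniq _ (ab (X ⊗ Y) Z) _ _ ((X ⊗ Y) ⊗ Z) (Z ⊗ (X ⊗ Y))).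
- by ty.
- by ty.
- exact: abK.
rewrite ab_hexl -acA (acA (at2 (ai X) _)).
rewrite -(@at_c _ _ _ _ _ X X X (Z ⊗ Y) (Y ⊗ Z) (Z ⊗ Y)); try by ty.
rewrite abVK (@ac1a _ (ai X) X); last by ty.
rewrite at_i (@ac1a _ _ (Z ⊗ (X ⊗ Y)) (X ⊗ (Z ⊗ Y))); last by ty.
rewrite -(@at_c _ _ _ _ _ (Z ⊗ X) (X ⊗ Z) (Z ⊗ X) Y Y Y); try by ty.
by rewrite abVK (@ac1a _ (ai Y) Y) ?at_i ?tensOA //; ty.
Qed.

Lemma aidem1 (D : Category) (a b : arr D) (X : D) :
  typed a X X -> ac b a = ai X -> a = ac a a -> a = ai X.
Proof. by move=> ta ba aa; rewrite -ba {2}aa acA ba (ac1a ta). Qed.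

Lemma abX1 X : ab X 𝟏 = ai X.
Proof.
apply: (@aidem1 _ _ (abv X 𝟏)); first by ty.
- by rewrite abK tensO1.
- by rewrite -{1}(tens1O 𝟏) ab_hexr at1a ata1.
Qed.
End BraidedArrows.

Section AffTensor.
Variable C : BraidedStrictMonoidal.
Implicit Types X Y Z W : C.
#[local] Hint Resolve typed_b typed_bv : typed_db.
Notation ι := (affIn C).

Lemma ab1Xv X : abv 𝟏 X = ai X.
Proof.
apply: (@aidem1 _ _ (ab 𝟏 X)); first by ty.
- by rewrite abVK tensO1.
- by rewrite -{1}(tens1O 𝟏) abv_hexl at1a ata1.
Qed.

Definition tensFr (Z : C) : Functor C C.
Proof.
refine (@MkFunctor C C (fun X => X ⊗ Z) (fun X Y f => f ⊠ idm Z) _ _).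
- by move=> X; rewrite tensH1.
- by move=> X Y W g f; rewrite -tensHM comp1f.
Defined.

Definition tensFl (X : C) : Functor C C.
Proof.
refine (@MkFunctor C C (fun Y => X ⊗ Y) (fun Y Z f => idm X ⊠ f) _ _).
- by move=> Y; rewrite tensH1.
- by move=> Y Z W g f; rewrite -tensHM comp1f.
Defined.

(* ξ_{X,Y} ⊗ 1_Z = ξ_{X ⊗ Z, Y} ∘ (1_X ⊗ β_{Y,Z}), and its inverse *)
Definition affXiR X Y Z : @Hom (AffCat C) ((X ⊗ Y) ⊗ Z) ((Y ⊗ X) ⊗ Z) :=
  fH ι (asc Y X Z) ∘ affXi (X ⊗ Z) Y
  ∘ fH ι (asc X Z Y ∘ (idm X ⊠ braid Y Z) ∘ ascV X Y Z).
Definition affXiRV X Y Z : @Hom (AffCat C) ((Y ⊗ X) ⊗ Z) ((X ⊗ Y) ⊗ Z) :=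
  fH ι (asc X Y Z ∘ (idm X ⊠ braidV Y Z) ∘ ascV X Z Y)
  ∘ affXiV (X ⊗ Z) Y ∘ fH ι (ascV Y X Z).

(* 1_X ⊗ ξ_{Y,Z} = (β_{X,Z}^{-1} ⊗ 1_Y) ∘ ξ_{X ⊗ Y, Z}, and its inverse *)
Definition affXiL X Y Z : @Hom (AffCat C) (X ⊗ (Y ⊗ Z)) (X ⊗ (Z ⊗ Y)) :=
  fH ι (ascV X Z Y ∘ (braidV X Z ⊠ idm Y) ∘ asc Z X Y)
  ∘ affXi (X ⊗ Y) Z ∘ fH ι (asc X Y Z).
Definition affXiLV X Y Z : @Hom (AffCat C) (X ⊗ (Z ⊗ Y)) (X ⊗ (Y ⊗ Z)) :=
  fH ι (ascV X Y Z) ∘ affXiV (X ⊗ Y) Z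
  ∘ fH ι (ascV Z X Y ∘ (braid X Z ⊠ idm Y) ∘ asc X Z Y).

Notation I := (amap ι).
Let x X Y : arr (AffCat C) := pack (affXi X Y).
Let xv X Y : arr (AffCat C) := pack (affXiV X Y).

Lemma typed_x X Y : @typed (AffCat C) (x X Y) (X ⊗ Y) (Y ⊗ X).
Proof. exact: typed_pack. Qed.
Lemma typed_xv X Y : @typed (AffCat C) (xv X Y) (Y ⊗ X) (X ⊗ Y).
Proof. exact: typed_pack. Qed.
Lemma typed_I a X Y : typed a X Y -> @typed (AffCat C) (I a) X Y.
Proof. by move=> [f ->]; apply: (typed_pack (fH ι f)). Qed.
#[local] Hint Resolve typed_x typed_xv : typed_db.

Local Ltac ty ::=
  lazymatch goal with
  | |- typed (ac _ _) _ _ => eapply typed_eq; [eapply typed_c; ty | ty | ty]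
  | |- typed (at2 _ _) _ _ => eapply typed_eq; [eapply typed_t; ty | ty | ty]
  | |- typed (amap _ _) _ _ => eapply typed_eq; [eapply typed_I; ty | ty | ty]
  | |- typed _ _ _ => eapply typed_eq; [eauto with typed_db nocore | ty | ty]
  | |- _ => try reflexivity; try (rewrite ?tensOA ?tens1O ?tensO1; reflexivity)
  end.
Local Ltac sid := repeat first [erewrite ac1a by ty | erewrite aca1 by ty].

Lemma I_c b a : I (ac b a) = ac (I b) (I a).
Proof.
case: b a => [[Y' [Z g]]|] [[X [Y f]]|] //=; case: pselect => //= e.
case: Y' / e g => g; congr (pack _).
rewrite -[LHS]/(fH ι (g ∘ (idm Y ∘ f))) comp1f fHM.
by rewrite -[RHS]/(fH ι g ∘ (idm (Y : AffCat C) ∘ fH ι f)) comp1f.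
Qed.
Lemma I_i X : I (ai X) = ai (X : AffCat C). Proof. by []. Qed.
Lemma pack_in X Y (f : Hom X Y) : pack (fH ι f) = I (pack f).
Proof. by []. Qed.
Lemma pack_braid X Y : pack (braid X Y) = ab X Y. Proof. by []. Qed.
Lemma pack_braidV X Y : pack (braidV X Y) = abv X Y. Proof. by []. Qed.
Lemma pack_idm (D : Category) (X : D) : pack (idm X) = ai X. Proof. by []. Qed.
Let packE := (pack_in, pack_comp, pack_idto, pack_tens, pack_braid, pack_braidV,
  pack_idm, I_c, at_i, I_i).

Lemma pack_Fr Z X Y (f : Hom X Y) :
  pack (fH (compF ι (tensFr Z)) f) = I (at2 (pack f) (ai Z)).
Proof. by []. Qed.
Lemma pack_Fl Z X Y (f : Hom X Y) :
  pack (fH (compF ι (tensFl Z)) f) = I (at2 (ai Z) (pack f)).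
Proof. by []. Qed.

Lemma xK X Y : ac (xv X Y) (x X Y) = ai (X ⊗ Y : AffCat C).
Proof. by rewrite -pack_comp affXiK. Qed.
Lemma xVK X Y : ac (x X Y) (xv X Y) = ai (Y ⊗ X : AffCat C).
Proof. by rewrite -pack_comp affXiVK. Qed.
Lemma x_nat f g X1 X2 Y1 Y2 : typed f Y1 Y2 -> typed g X1 X2 ->
  ac (x X2 Y2) (I (at2 g f)) = ac (I (at2 f g)) (x X1 Y1).
Proof.
move=> [{}f ->] [{}g ->]; rewrite -!pack_tens -!pack_in -!pack_comp.
by rewrite affXi_nat.
Qed.
Lemma x_tens X Y Z : x X (Y ⊗ Z) = ac (x (Z ⊗ X) Y) (x (X ⊗ Y) Z).
Proof.
rewrite /x affXi_tens !packE -!/(x _ _).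
by sid.
Qed.
Lemma xX1 X : x X 𝟏 = ai (X : AffCat C).
Proof.
apply: (@aidem1 _ _ (xv X 𝟏)); first by ty.
- by rewrite xK tensO1.
- by rewrite -{1}(tens1O 𝟏) x_tens tens1O tensO1.
Qed.

Lemma at_cl f g X Y Y' Y'' : typed f Y Y' -> typed g Y' Y'' ->
  at2 (ai X) (ac g f) = ac (at2 (ai X) g) (at2 (ai X) f).
Proof.
move=> tf tg; rewrite -(@at_c _ _ _ _ _ X X X Y Y' Y'') //; try by ty.
by rewrite (@ac1a _ _ X X) //; ty.
Qed.
Lemma at_cr f g X Y Y' Y'' : typed f Y Y' -> typed g Y' Y'' ->
  at2 (ac g f) (ai X) = ac (at2 g (ai X)) (at2 f (ai X)).
Proof.
move=> tf tg; rewrite -(@at_c _ _ _ _ _ Y Y' Y'' X X X) //; try by ty.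
by rewrite (@ac1a _ _ X X) //; ty.
Qed.
Lemma at_swap f g X X' Y Y' : typed f X X' -> typed g Y Y' ->
  ac (at2 f (ai Y')) (at2 (ai X) g) = ac (at2 (ai X') g) (at2 f (ai Y)).
Proof.
move=> tf tg; rewrite -(@at_c _ _ _ _ _ X X X' Y Y' Y') //; try by ty.
rewrite -(@at_c _ _ _ _ _ X X' X' Y Y Y') //; try by ty.
by rewrite !(ac1a tf) !(aca1 tf) !(ac1a tg) !(aca1 tg).
Qed.

Lemma pack_xiR X Y Z :
  pack (affXiR X Y Z) = ac (x (X ⊗ Z) Y) (I (at2 (ai X) (ab Y Z))).
Proof. rewrite /affXiR !packE -!/(x _ _); by sid. Qed.
Lemma pack_xiRV X Y Z :
  pack (affXiRV X Y Z) = ac (I (at2 (ai X) (abv Y Z))) (xv (X ⊗ Z) Y).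
Proof. rewrite /affXiRV !packE -!/(xv _ _); by sid. Qed.
Lemma pack_xiL X Y Z :
  pack (affXiL X Y Z) = ac (I (at2 (abv X Z) (ai Y))) (x (X ⊗ Y) Z).
Proof. rewrite /affXiL !packE -!/(x _ _); by sid. Qed.
Lemma pack_xiLV X Y Z :
  pack (affXiLV X Y Z) = ac (xv (X ⊗ Y) Z) (I (at2 (ab X Z) (ai Y))).
Proof. rewrite /affXiLV !packE -!/(xv _ _); by sid. Qed.

Lemma affXiRK X Y Z : affXiRV X Y Z ∘ affXiR X Y Z = idm _.
Proof.
apply: pack_inj; rewrite pack_comp pack_xiR pack_xiRV -acA (acA (xv _ _)) xK.
sid; rewrite -I_c -(@at_cl _ _ _ (Y ⊗ Z) (Z ⊗ Y) (Y ⊗ Z)); try by ty.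
by rewrite abK at_i tensOA.
Qed.
Lemma affXiRVK X Y Z : affXiR X Y Z ∘ affXiRV X Y Z = idm _.
Proof.
apply: pack_inj; rewrite pack_comp pack_xiR pack_xiRV -acA (acA (I _)).
rewrite -I_c -(@at_cl _ _ _ (Z ⊗ Y) (Y ⊗ Z) (Z ⊗ Y)); try by ty.
by rewrite abVK at_i I_i; sid; rewrite xVK tensOA.
Qed.
Lemma affXiLK X Y Z : affXiLV X Y Z ∘ affXiL X Y Z = idm _.
Proof.
apply: pack_inj; rewrite pack_comp pack_xiL pack_xiLV -acA (acA (I _)).
rewrite -I_c -(@at_cr _ _ _ (Z ⊗ X) (X ⊗ Z) (Z ⊗ X)); try by ty.
by rewrite abVK at_i I_i; sid; rewrite xK tensOA.
Qed.
Lemma affXiLVK X Y Z : affXiL X Y Z ∘ affXiLV X Y Z = idm _.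
Proof.
apply: pack_inj; rewrite pack_comp pack_xiL pack_xiLV -acA (acA (x _ _)) xVK.
sid; rewrite -I_c -(@at_cr _ _ _ (X ⊗ Z) (Z ⊗ X) (X ⊗ Z)); try by ty.
by rewrite abK at_i tensOA.
Qed.

Lemma affXiR_tens Z X Y W :
  affXiR X (Y ⊗ W) Z
  = fH (compF ι (tensFr Z)) (asc Y W X) ∘ (affXiR (W ⊗ X) Y Z ∘
      (fH (compF ι (tensFr Z)) (asc W X Y) ∘
        (affXiR (X ⊗ Y) W Z ∘ fH (compF ι (tensFr Z)) (asc X Y W)))).
Proof.
apply: pack_inj; rewrite !(pack_xiR, packE, pack_Fr) -!/(x _ _); sid.
rewrite -!acA (acA (I _)) -at_i -atA.
rewrite -(@x_nat (ai W) _ (X ⊗ Y ⊗ Z) (X ⊗ Z ⊗ Y) W W); try by ty.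
rewrite ab_hexl (@at_cl _ _ _ (Y ⊗ W ⊗ Z) (Y ⊗ Z ⊗ W) (Z ⊗ Y ⊗ W)); try by ty.
by rewrite I_c x_tens -at_i !tensOA !atA !acA.
Qed.
Lemma affXiR_nat Z X1 X2 Y1 Y2 (f : Hom Y1 Y2) (g : Hom X1 X2) :
  affXiR X2 Y2 Z ∘ fH (compF ι (tensFr Z)) (g ⊠ f)
  = fH (compF ι (tensFr Z)) (f ⊠ g) ∘ affXiR X1 Y1 Z.
Proof.
apply: pack_inj; rewrite !(pack_xiR, packE, pack_Fr) -!/(x _ _).
move: (typed_pack f) (typed_pack g); move: (pack f) (pack g) => {}f {}g tf tg.
rewrite -!acA -I_c -!atA -(@at_c _ _ _ _ _ X1 X2 X2 (Y1 ⊗ Z) (Y2 ⊗ Z) (Z ⊗ Y2));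
  try by ty.
rewrite (ac1a tg) (@ab_nat _ f (ai Z) Y1 Y2 Z Z) //; try by ty.
rewrite -[in LHS](aca1 tg) (@at_c _ _ _ _ _ X1 X1 X2 (Y1 ⊗ Z) (Z ⊗ Y1) (Z ⊗ Y2));
  try by ty.
rewrite I_c !acA atA (@x_nat f _ (X1 ⊗ Z) (X2 ⊗ Z) Y1 Y2) //; try by ty.
Qed.

Lemma affXiL_tens X Y Z W :
  affXiL X Y (Z ⊗ W)
  = fH (compF ι (tensFl X)) (asc Z W Y) ∘ (affXiL X (W ⊗ Y) Z ∘
      (fH (compF ι (tensFl X)) (asc W Y Z) ∘
        (affXiL X (Y ⊗ Z) W ∘ fH (compF ι (tensFl X)) (asc Y Z W)))).
Proof.
apply: pack_inj; rewrite !(pack_xiL, packE, pack_Fl) -!/(x _ _); sid.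
rewrite -!acA (acA (x _ _)) -(at_i Y Z) atA !tensOA.
rewrite (@x_nat (ai Z) _ (W ⊗ X ⊗ Y) (X ⊗ W ⊗ Y) Z Z); try by ty.
rewrite abv_hexr (@at_cr _ _ _ (Z ⊗ W ⊗ X) (Z ⊗ X ⊗ W) (X ⊗ Z ⊗ W)); try by ty.
by rewrite I_c x_tens -?at_i !tensOA !atA !acA.
Qed.
Lemma affXiL_nat X Y1 Y2 Z1 Z2 (f : Hom Z1 Z2) (g : Hom Y1 Y2) :
  affXiL X Y2 Z2 ∘ fH (compF ι (tensFl X)) (g ⊠ f)
  = fH (compF ι (tensFl X)) (f ⊠ g) ∘ affXiL X Y1 Z1.
Proof.
apply: pack_inj; rewrite !(pack_xiL, packE, pack_Fl) -!/(x _ _).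
move: (typed_pack f) (typed_pack g); move: (pack f) (pack g) => {}f {}g tf tg.
rewrite -!acA atA (@x_nat f _ (X ⊗ Y1) (X ⊗ Y2) Z1 Z2) //; try by ty.
rewrite !acA -!I_c !atA; congr (ac (I _) _).
rewrite -(@at_c _ _ _ _ _ (Z1 ⊗ X) (Z2 ⊗ X) (X ⊗ Z2) Y1 Y2 Y2); try by ty.
rewrite -(@at_c _ _ _ _ _ (Z1 ⊗ X) (X ⊗ Z1) (X ⊗ Z2) Y1 Y1 Y2); try by ty.
by rewrite (ac1a tg) (aca1 tg) (@abv_nat _ (ai X) f X X Z1 Z2) //; ty.
Qed.

(* The endofunctors - ⊗ 1_Z and 1_X ⊗ - of the affinization. *)
Definition affR (Z : C) : Functor (AffCat C) (AffCat C) :=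
  @affLift C (AffCat C) (compF ι (tensFr Z))
    (fun X Y => affXiR X Y Z) (fun X Y => affXiRV X Y Z)
    (fun X Y => affXiRK X Y Z) (fun X Y => affXiRVK X Y Z)
    (affXiR_tens Z) (affXiR_nat Z).
Definition affL (X : C) : Functor (AffCat C) (AffCat C) :=
  @affLift C (AffCat C) (compF ι (tensFl X)) (affXiL X) (affXiLV X)
    (affXiLK X) (affXiLVK X) (affXiL_tens X) (affXiL_nat X).

Lemma affR_in Z X Y (f : Hom X Y) : fH (affR Z) (fH ι f) = fH ι (f ⊠ idm Z).
Proof. exact: affLift_in. Qed.
Lemma affR_xi Z X Y : fH (affR Z) (affXi X Y) = affXiR X Y Z.
Proof. exact: affLift_xi. Qed.
Lemma affL_in Z X Y (f : Hom X Y) : fH (affL Z) (fH ι f) = fH ι (idm Z ⊠ f).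
Proof. exact: affLift_in. Qed.
Lemma affL_xi X Y Z : fH (affL X) (affXi Y Z) = affXiL X Y Z.
Proof. exact: affLift_xi. Qed.

Lemma aswap1 X Y Z W :
  ac (at2 (ai X) (ab Y (W ⊗ Z))) (at2 (abv (X ⊗ Y) W) (ai Z))
  = ac (at2 (at2 (abv X W) (ai Z)) (ai Y)) (at2 (ai W) (at2 (ai X) (ab Y Z))).
Proof.
rewrite ab_hexr abv_hexl.
rewrite (@at_cl _ _ _ (Y ⊗ W ⊗ Z) (W ⊗ Y ⊗ Z) (W ⊗ Z ⊗ Y)); try by ty.
rewrite (@at_cr _ _ _ (W ⊗ X ⊗ Y) (X ⊗ W ⊗ Y) (X ⊗ Y ⊗ W)); try by ty.
rewrite -acA (acA (at2 _ (at2 (ab _ _) _))) !atA.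
rewrite -(@at_cr (at2 (ai X) (abv Y W)) (at2 (ai X) (ab Y W)) _
  (X ⊗ W ⊗ Y) (X ⊗ Y ⊗ W) (X ⊗ W ⊗ Y)); try by ty.
rewrite -(@at_cl _ _ _ (W ⊗ Y) (Y ⊗ W) (W ⊗ Y)); try by ty.
rewrite abVK !at_i; sid.
rewrite -!atA !at_i.
by rewrite -(@at_swap (abv X W) (ab Y Z) (W ⊗ X) (X ⊗ W) (Y ⊗ Z) (Z ⊗ Y)) //; ty.
Qed.

Lemma aff_swap_xi X Y Z W :
  affXiR X Y (W ⊗ Z) ∘ affXiL (X ⊗ Y) Z W
  = affXiL (Y ⊗ X) Z W ∘ affXiR X Y (Z ⊗ W).
Proof.
apply: pack_inj; rewrite !(pack_xiR, pack_xiL, pack_comp).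
transitivity (ac (I (at2 (ai Y) (at2 (abv X W) (ai Z))))
  (ac (x (X ⊗ Z) (Y ⊗ W)) (I (at2 (at2 (ai X) (ab Y Z)) (ai W))))).
- rewrite -!acA (acA (I _)) -I_c aswap1 I_c !acA tensOA.
  rewrite (@x_nat (ai Y) _ (W ⊗ X ⊗ Z) (X ⊗ W ⊗ Z) Y Y); try by ty.
  rewrite -!acA -(@x_nat (ai W) _ (X ⊗ Y ⊗ Z) (X ⊗ Z ⊗ Y) W W); try by ty.
  by rewrite x_tens !tensOA !acA.
- rewrite -!acA (acA (x _ _) (x _ _)) !tensOA -(tensOA Y X) -(x_tens _ W Y).
  rewrite ab_hexr (@at_cl _ _ _ (Y ⊗ Z ⊗ W) (Z ⊗ Y ⊗ W) (Z ⊗ W ⊗ Y)); try by ty.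
  rewrite I_c (acA (x _ (W ⊗ Y))) (atA (ai X) (ai Z)) at_i.
  rewrite (@x_nat (ab Y W) _ (X ⊗ Z) (X ⊗ Z) (Y ⊗ W) (W ⊗ Y)); try by ty.
  rewrite abv_hexl (@at_cr _ _ _ (W ⊗ Y ⊗ X) (Y ⊗ W ⊗ X) (Y ⊗ X ⊗ W)); try by ty.
  rewrite I_c -!acA (acA (I (at2 (at2 (abv _ _) _) _))) -I_c -(atA (abv _ _)) at_i.
  rewrite -(@at_cr _ _ _ (Y ⊗ W) (W ⊗ Y) (Y ⊗ W)); try by ty.
  by rewrite abK at_i I_i; sid; rewrite !atA.
Qed.

Lemma aff_swap X X' Y Y' (f : @Hom (AffCat C) X X') (g : @Hom (AffCat C) Y Y') :
  fH (affR Y') f ∘ fH (affL X) g = fH (affL X') g ∘ fH (affR Y) f.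
Proof.
apply: (@affNat C (AffCat C) (affL X) (affL X') (fun Y => fH (affR Y) f)
  _ _ Y Y' g) => {Y Y' g} [Y Y' g|Y Z]; apply: esym.
- apply: (@affNat C (AffCat C) (affR Y) (affR Y')
    (fun X => fH (affL X) (fH ι g)) _ _ X X' f) => {X X' f} [X X' f|X Z]; cbv beta.
  + rewrite !affR_in !affL_in; apply: pack_inj; rewrite !packE -!I_c.
    by rewrite (at_swap (typed_pack f) (typed_pack g)).
  + rewrite !affR_xi !affL_in; apply: pack_inj.
    rewrite !(pack_xiR, packE).
    have tg := typed_pack g; move: (pack g) tg => {}g tg.
    rewrite -!acA -!I_c -!at_i -!atA.
    rewrite -(@at_cl _ _ _ (Z ⊗ Y) (Z ⊗ Y') (Y' ⊗ Z)); try by ty.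
    rewrite (@ab_nat _ (ai Z) g Z Z Y Y') //; try by ty.
    rewrite (@at_cl _ _ _ (Z ⊗ Y) (Y ⊗ Z) (Y' ⊗ Z)); try by ty.
    rewrite I_c !acA atA.
    by rewrite (atA _ g) (@x_nat (ai Z) _ (X ⊗ Y) (X ⊗ Y') Z Z) ?atA //; ty.
- apply: (@affNat C (AffCat C) (affR (Y ⊗ Z)) (affR (Z ⊗ Y))
    (fun X => fH (affL X) (affXi Y Z)) _ _ X X' f) => {X X' f} [X X' f|X W]; cbv beta.
  + rewrite !affR_in !affL_xi; apply: pack_inj.
    rewrite !(pack_xiL, packE).
    have tf := typed_pack f; move: (pack f) tf => {}f tf.
    rewrite -!acA -!at_i !atA.
    rewrite (@x_nat (ai Z) _ (X ⊗ Y) (X' ⊗ Y) Z Z) //; try by ty.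
    rewrite !acA -!I_c !atA.
    rewrite -(@at_cr _ _ _ (Z ⊗ X) (Z ⊗ X') (X' ⊗ Z)); try by ty.
    rewrite (@abv_nat _ f (ai Z) X X' Z Z) //; try by ty.
    by rewrite (@at_cr _ _ _ (Z ⊗ X) (X ⊗ Z) (X' ⊗ Z)) //; ty.
  + by rewrite !affR_xi !affL_xi; apply: esym; apply: aff_swap_xi.
Qed.

Definition affTens (X X' Y Y' : C)
    (f : @Hom (AffCat C) X X') (g : @Hom (AffCat C) Y Y') :
    @Hom (AffCat C) (X ⊗ Y) (X' ⊗ Y') :=
  fH (affR Y') f ∘ fH (affL X) g.

(* Two functors out of the affinization that agree on C and on the ξ_{X,Y},
   up to equalities of objects, agree on all morphisms. *)
Lemma aff_ext (F G : Functor (AffCat C) (AffCat C))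
    (e : forall X : C, F X = G X) :
  (forall X Y (f : @Hom C X Y),
     pack (fH F (fH ι f)) = pack (fH G (fH ι f))) ->
  (forall X Y, pack (fH F (affXi X Y)) = pack (fH G (affXi X Y))) ->
  forall (X Y : C) (f : @Hom (AffCat C) X Y), pack (fH F f) = pack (fH G f).
Proof.
move=> ein exi X Y f; apply: (@pack_eq_idto _ _ _ _ _ _ _ (e X) (e Y)).
apply: (@affNat C (AffCat C) F G (fun X => idto (e X)) _ _ X Y f).
- by move=> ? ? ?; apply: idto_pack; apply: ein.
- by move=> ? ?; apply: idto_pack; apply: exi.
Qed.

Lemma pack_fH (D E : Category) (F : Functor D E) (X Y : D) (f : Hom X Y) :
  pack (fH F f) = amap F (pack f).
Proof. by []. Qed.
Lemma pack_compF (D E G : Category) (F : Functor E G) (F' : Functor D E)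
  (X Y : D) (f : Hom X Y) : pack (fH (compF F F') f) = amap F (pack (fH F' f)).
Proof. by []. Qed.
Lemma amapR_in Z a : amap (affR Z) (I a) = I (at2 a (ai Z)).
Proof. by case: a => [[X [Y f]]|] //; rewrite -[LHS]/(pack (fH (affR Z) (fH ι f))) affR_in. Qed.
Lemma amapL_in Z a : amap (affL Z) (I a) = I (at2 (ai Z) a).
Proof. by case: a => [[X [Y f]]|] //; rewrite -[LHS]/(pack (fH (affL Z) (fH ι f))) affL_in. Qed.
Lemma amapR_x Z X Y :
  amap (affR Z) (x X Y) = ac (x (X ⊗ Z) Y) (I (at2 (ai X) (ab Y Z))).
Proof. by rewrite -pack_fH affR_xi pack_xiR. Qed.
Lemma amapL_x X Y Z :
  amap (affL X) (x Y Z) = ac (I (at2 (abv X Z) (ai Y))) (x (X ⊗ Y) Z).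
Proof. by rewrite -pack_fH affL_xi pack_xiL. Qed.
Lemma amapc (F : Functor (AffCat C) (AffCat C)) b a X Y Z :
  @typed (AffCat C) a X Y -> @typed (AffCat C) b Y Z ->
  amap F (ac b a) = ac (amap F b) (amap F a).
Proof. exact: amap_c. Qed.

Lemma affRR Y Z X X' (f : @Hom (AffCat C) X X') :
  pack (fH (affR Z) (fH (affR Y) f)) = pack (fH (affR (Y ⊗ Z)) f).
Proof.
move: X X' f; apply: (@aff_ext (compF (affR Z) (affR Y)) (affR (Y ⊗ Z))).
- by move=> X; apply: esym; apply: tensOA.
- move=> X X' f; rewrite pack_compF !affR_in !packE amapR_in.
  by rewrite -atA at_i.
- move=> X W; rewrite pack_compF !affR_xi !pack_xiR.
  rewrite (@amapc _ _ _ (X ⊗ W ⊗ Y) (X ⊗ Y ⊗ W) (W ⊗ X ⊗ Y)); try by ty.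
  rewrite amapR_x amapR_in -acA -I_c -at_i -!atA.
  rewrite -(@at_cl _ _ _ (W ⊗ Y ⊗ Z) (Y ⊗ W ⊗ Z) (Y ⊗ Z ⊗ W)); try by ty.
  by rewrite ab_hexr tensOA.
Qed.

Lemma affLL X Y Z Z' (f : @Hom (AffCat C) Z Z') :
  pack (fH (affL X) (fH (affL Y) f)) = pack (fH (affL (X ⊗ Y)) f).
Proof.
move: Z Z' f; apply: (@aff_ext (compF (affL X) (affL Y)) (affL (X ⊗ Y))).
- by move=> Z; apply: tensOA.
- move=> Z Z' f; rewrite pack_compF !affL_in !packE amapL_in.
  by rewrite atA at_i.
- move=> Z W; rewrite pack_compF !affL_xi !pack_xiL.
  rewrite (@amapc _ _ _ (Y ⊗ Z ⊗ W) (W ⊗ Y ⊗ Z) (Y ⊗ W ⊗ Z)); try by ty.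
  rewrite amapL_x amapL_in !acA -I_c -at_i !atA.
  rewrite -(@at_cr _ _ _ (W ⊗ X ⊗ Y) (X ⊗ W ⊗ Y) (X ⊗ Y ⊗ W)); try by ty.
  by rewrite abv_hexl tensOA.
Qed.

Lemma affLR X Z Y Y' (f : @Hom (AffCat C) Y Y') :
  pack (fH (affL X) (fH (affR Z) f)) = pack (fH (affR Z) (fH (affL X) f)).
Proof.
move: Y Y' f; apply: (@aff_ext (compF (affL X) (affR Z)) (compF (affR Z) (affL X))).
- by move=> Y; apply: tensOA.
- move=> Y Y' f; rewrite !pack_compF !affL_in !affR_in !packE amapL_in amapR_in.
  by rewrite atA.
- move=> Y W; rewrite !pack_compF !affL_xi !affR_xi !pack_xiL !pack_xiR.
  rewrite (@amapc _ _ _ (Y ⊗ W ⊗ Z) (Y ⊗ Z ⊗ W) (W ⊗ Y ⊗ Z)); try by ty.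
  rewrite (@amapc _ _ _ (X ⊗ Y ⊗ W) (W ⊗ X ⊗ Y) (X ⊗ W ⊗ Y)); try by ty.
  by rewrite amapL_x amapL_in amapR_x amapR_in -!at_i !atA !tensOA !acA.
Qed.

Lemma affR1 Y Y' (f : @Hom (AffCat C) Y Y') : pack (fH (affR 𝟏) f) = pack f.
Proof.
move: Y Y' f; apply: (@aff_ext (affR 𝟏) (idF _)).
- by move=> Y; apply: tensO1.
- by move=> Y Y' f; rewrite affR_in !packE ata1.
- by move=> Y W; rewrite affR_xi pack_xiR abX1 at_i tensO1 I_i; sid.
Qed.

Lemma affL1 Y Y' (f : @Hom (AffCat C) Y Y') : pack (fH (affL 𝟏) f) = pack f.
Proof.
move: Y Y' f; apply: (@aff_ext (affL 𝟏) (idF _)).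
- by move=> Y; apply: tens1O.
- by move=> Y Y' f; rewrite affL_in !packE at1a.
- move=> Y W; rewrite affL_xi pack_xiL ab1Xv at_i tens1O I_i; by sid.
Qed.

Definition Aff : StrictMonoidal.
Proof.
refine (@MkStrictMonoidal (AffCat C) 𝟏 (@tensO C) affTens
  (@tensOA C) (@tens1O C) (@tensO1 C) _ _ _ _ _).
- by move=> X Y; rewrite /affTens !fH1 comp1f.
- move=> X X' X'' Y Y' Y'' f' f g' g; rewrite /affTens !fHM.
  by rewrite -!compA; congr (_ ∘ _); rewrite !compA aff_swap.
- move=> X X' Y Y' Z Z' f g h; apply: idto_pack.
  rewrite /affTens !(fHM, pack_comp) -acA.
  by rewrite affRR affLL affLR.
- move=> X Y f; apply: idto_pack.
  by rewrite /affTens fH1 comp1f affL1.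
- move=> X Y f; apply: idto_pack.
  by rewrite /affTens fH1 compf1 affR1.
Defined.

(* The tensor product of Aff is the unique one that extends the tensor product
   of C and takes the prescribed values on ξ_{X,Y} ⊗ 1_Z and 1_X ⊗ ξ_{Y,Z}. *)
Lemma Aff_in X X' Y Y' (f : Hom X X') (g : Hom Y Y') :
  tensH (s := Aff) (fH ι f) (fH ι g) = fH ι (f ⊠ g).
Proof.
apply: pack_inj; rewrite -[LHS]/(pack (_ ∘ _)) pack_comp affR_in affL_in !packE.
rewrite -I_c; congr (I _).
rewrite -(@at_c _ _ _ _ _ X X X' Y Y' Y'); try by ty.
by rewrite (aca1 (typed_pack f)) (ac1a (typed_pack g)).
Qed.

Lemma Aff_xi_tens1 X Y Z :
  tensH (s := Aff) (affXi X Y) (idm (Z : AffCat C)) = affXiR X Y Z.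
Proof. by rewrite -[LHS]/(_ ∘ _) fH1 compf1 affR_xi. Qed.

Lemma Aff_1tens_xi X Y Z :
  tensH (s := Aff) (idm (X : AffCat C)) (affXi Y Z) = affXiL X Y Z.
Proof. by rewrite -[LHS]/(_ ∘ _) fH1 comp1f affL_xi. Qed.

Lemma Aff_tens_unique
    (T : forall X X' Y Y' : C, @Hom (AffCat C) X X' -> @Hom (AffCat C) Y Y' ->
       @Hom (AffCat C) (X ⊗ Y) (X' ⊗ Y')) :
  (forall X Y, T X X Y Y (idm (X : AffCat C)) (idm (Y : AffCat C))
     = idm (X ⊗ Y : AffCat C)) ->
  (forall X X' X'' Y Y' Y''
     (f' : @Hom (AffCat C) X' X'') (f : @Hom (AffCat C) X X')
     (g' : @Hom (AffCat C) Y' Y'') (g : @Hom (AffCat C) Y Y'),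
     T _ _ _ _ (f' ∘ f) (g' ∘ g) = T _ _ _ _ f' g' ∘ T _ _ _ _ f g) ->
  (forall X X' Y Y' (f : Hom X X') (g : Hom Y Y'),
     T _ _ _ _ (fH ι f) (fH ι g) = fH ι (f ⊠ g)) ->
  (forall X Y Z,
     T _ _ _ _ (affXi X Y) (idm (Z : AffCat C)) = affXiR X Y Z) ->
  (forall X Y Z,
     T _ _ _ _ (idm (X : AffCat C)) (affXi Y Z) = affXiL X Y Z) ->
  forall X X' Y Y' (f : @Hom (AffCat C) X X') (g : @Hom (AffCat C) Y Y'),
    T _ _ _ _ f g = tensH (s := Aff) f g.
Proof.
move=> T1 TM Tin Tr Tl X X' Y Y' f g.
have Rc Z : forall (U V : AffCat C) (h : Hom U V),
    T _ _ _ _ h (idm (Z : AffCat C)) = fH (affR Z) h.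
  have TMr U V W (k : @Hom (AffCat C) V W) (h : @Hom (AffCat C) U V) :
      T _ _ _ _ (k ∘ h) (idm (Z : AffCat C))
      = T _ _ _ _ k (idm (Z : AffCat C)) ∘ T _ _ _ _ h (idm (Z : AffCat C)).
    by rewrite -TM comp1f.
  pose F := @MkFunctor (AffCat C) (AffCat C) (fun U => (U : C) ⊗ Z)
    (fun U V h => T U V Z Z h (idm (Z : AffCat C))) (fun U => T1 U Z) TMr.
  move=> U V h; rewrite -[LHS]comp1f -[RHS]compf1.
  apply: (@affNat C (AffCat C) F (affR Z)
    (fun W => idm (W ⊗ Z : AffCat C))) => {U V h} [U V h|U V].
  - by rewrite comp1f compf1 affR_in -(Tin _ _ _ _ h (idm Z)).
  - by rewrite comp1f compf1 affR_xi -Tr.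
have Lc Z : forall (U V : AffCat C) (h : Hom U V),
    T _ _ _ _ (idm (Z : AffCat C)) h = fH (affL Z) h.
  have TMl U V W (k : @Hom (AffCat C) V W) (h : @Hom (AffCat C) U V) :
      T _ _ _ _ (idm (Z : AffCat C)) (k ∘ h)
      = T _ _ _ _ (idm (Z : AffCat C)) k ∘ T _ _ _ _ (idm (Z : AffCat C)) h.
    by rewrite -TM comp1f.
  pose F := @MkFunctor (AffCat C) (AffCat C) (fun U => Z ⊗ (U : C))
    (fun U V h => T Z Z U V (idm (Z : AffCat C)) h) (fun U => T1 Z U) TMl.
  move=> U V h; rewrite -[LHS]comp1f -[RHS]compf1.
  apply: (@affNat C (AffCat C) F (affL Z)
    (fun W => idm (Z ⊗ W : AffCat C))) => {U V h} [U V h|U V].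
  - by rewrite comp1f compf1 affL_in -(Tin _ _ _ _ (idm Z) h).
  - by rewrite comp1f compf1 affL_xi -Tl.
by rewrite -[RHS]/(_ ∘ _) -Rc -Lc -TM compf1 comp1f.
Qed.
End AffTensor.

(* Formal composites and tensor products of morphisms of C, of the ξ_X and of
   their inverses. *)
Inductive xiTerm (C : BraidedStrictMonoidal) : C -> C -> Type :=
| xIn X Y (f : Hom X Y) : xiTerm X Y
| xXi X : xiTerm X X
| xXiV X : xiTerm X X
| xComp X Y Z (t : xiTerm Y Z) (s : xiTerm X Y) : xiTerm X Z
| xTens X X' Y Y' (t : xiTerm X X') (s : xiTerm Y Y') :
    xiTerm (X ⊗ Y) (X' ⊗ Y').
Arguments xIn {C X Y} f.
Arguments xXi {C} X.
Arguments xXiV {C} X.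
Arguments xComp {C X Y Z} t s.
Arguments xTens {C X X' Y Y'} t s.

(* The least congruence that makes the formal expressions a strict monoidal
   category, xIn a strict monoidal functor and each ξ_X invertible, and that
   contains the three defining relations. *)
Inductive xiEq (C : BraidedStrictMonoidal) :
    forall X Y : C, xiTerm X Y -> xiTerm X Y -> Prop :=
| xe_refl X Y (t : xiTerm X Y) : xiEq t t
| xe_sym X Y (t s : xiTerm X Y) : xiEq t s -> xiEq s t
| xe_trans X Y (t s u : xiTerm X Y) : xiEq t s -> xiEq s u -> xiEq t u
| xe_comp X Y Z (t t' : xiTerm Y Z) (s s' : xiTerm X Y) :
    xiEq t t' -> xiEq s s' -> xiEq (xComp t s) (xComp t' s')
| xe_tens X X' Y Y' (t t' : xiTerm X X') (s s' : xiTerm Y Y') :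
    xiEq t t' -> xiEq s s' -> xiEq (xTens t s) (xTens t' s')
| xe_assoc X Y Z W (u : xiTerm Z W) (t : xiTerm Y Z) (s : xiTerm X Y) :
    xiEq (xComp u (xComp t s)) (xComp (xComp u t) s)
| xe_idl X Y (t : xiTerm X Y) : xiEq (xComp (xIn (idm Y)) t) t
| xe_idr X Y (t : xiTerm X Y) : xiEq (xComp t (xIn (idm X))) t
| xe_tensM X X' X'' Y Y' Y'' (t' : xiTerm X' X'') (t : xiTerm X X')
    (s' : xiTerm Y' Y'') (s : xiTerm Y Y') :
    xiEq (xTens (xComp t' t) (xComp s' s)) (xComp (xTens t' s') (xTens t s))
| xe_tensA X X' Y Y' Z Z' (t : xiTerm X X') (s : xiTerm Y Y')
    (u : xiTerm Z Z') :
    xiEq (xComp (xIn (asc X' Y' Z')) (xTens t (xTens s u)))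
         (xComp (xTens (xTens t s) u) (xIn (asc X Y Z)))
| xe_tens1l X Y (t : xiTerm X Y) :
    xiEq (xComp (xIn (idto (tens1O Y))) (xTens (xIn (idm 𝟏)) t))
         (xComp t (xIn (idto (tens1O X))))
| xe_tens1r X Y (t : xiTerm X Y) :
    xiEq (xComp (xIn (idto (tensO1 Y))) (xTens t (xIn (idm 𝟏))))
         (xComp t (xIn (idto (tensO1 X))))
| xe_in_comp X Y Z (g : Hom Y Z) (f : Hom X Y) :
    xiEq (xIn (g ∘ f)) (xComp (xIn g) (xIn f))
| xe_in_tens X X' Y Y' (f : Hom X X') (g : Hom Y Y') :
    xiEq (xIn (f ⊠ g)) (xTens (xIn f) (xIn g))
| xe_xiK (X : C) : xiEq (xComp (xXiV X) (xXi X)) (xIn (idm X))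
| xe_xiVK (X : C) : xiEq (xComp (xXi X) (xXiV X)) (xIn (idm X))
| xe_xi_braid (X Y : C) :
    xiEq (xComp (xIn (braidV Y X)) (xTens (xXi X) (xIn (idm Y))))
         (xComp (xTens (xIn (idm Y)) (xXi X)) (xIn (braid X Y)))
| xe_xi_tens (X Y : C) : xiEq (xXi (X ⊗ Y)) (xTens (xXi X) (xXi Y))
| xe_xi_nat (X Y : C) (f : Hom X Y) :
    xiEq (xComp (xXi Y) (xIn f)) (xComp (xIn f) (xXi X)).

Section AdjXi.
Variable C : BraidedStrictMonoidal.

Definition xiHom (X Y : C) : Type :=
  quot (@xe_refl C X Y) (@xe_sym C X Y) (@xe_trans C X Y).
Definition xiPi (X Y : C) (t : xiTerm X Y) : xiHom X Y := qpi _ _ _ t.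
Definition xiRepr (X Y : C) (f : xiHom X Y) : xiTerm X Y := qrepr f.
Definition xiComp (X Y Z : C) (g : xiHom Y Z) (f : xiHom X Y) : xiHom X Z :=
  xiPi (xComp (xiRepr g) (xiRepr f)).
Definition xiTens (X X' Y Y' : C) (f : xiHom X X') (g : xiHom Y Y') :
  xiHom (X ⊗ Y) (X' ⊗ Y') := xiPi (xTens (xiRepr f) (xiRepr g)).

Lemma xiPiE (X Y : C) (t s : xiTerm X Y) : xiEq t s -> xiPi t = xiPi s.
Proof. exact: qpiE. Qed.
Lemma xiReprK (X Y : C) (f : xiHom X Y) : xiPi (xiRepr f) = f.
Proof. exact: qreprK. Qed.
Lemma xiReprP (X Y : C) (t : xiTerm X Y) : xiEq (xiRepr (xiPi t)) t.
Proof. exact: qreprP. Qed.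
Lemma xiCompE (X Y Z : C) (t : xiTerm Y Z) (s : xiTerm X Y) :
  xiComp (xiPi t) (xiPi s) = xiPi (xComp t s).
Proof. by apply: xiPiE; apply: xe_comp; apply: xiReprP. Qed.
Lemma xiTensE (X X' Y Y' : C) (t : xiTerm X X') (s : xiTerm Y Y') :
  xiTens (xiPi t) (xiPi s) = xiPi (xTens t s).
Proof. by apply: xiPiE; apply: xe_tens; apply: xiReprP. Qed.

Definition AdjXiCat : Category.
Proof.
refine (@MkCategory C xiHom (fun X => xiPi (xIn (idm X))) xiComp _ _ _).
- move=> X Y Z W h g f; rewrite -(xiReprK h) -(xiReprK g) -(xiReprK f).
  by rewrite !xiCompE; apply: xiPiE; apply: xe_assoc.
- by move=> X Y f; rewrite -(xiReprK f) xiCompE; apply: xiPiE; apply: xe_idl.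
- by move=> X Y f; rewrite -(xiReprK f) xiCompE; apply: xiPiE; apply: xe_idr.
Defined.

Lemma xiPi_idto (X Y : C) (e : X = Y) :
  idto (C := AdjXiCat) e = xiPi (xIn (idto e)).
Proof. by case: Y / e. Qed.

Definition AdjXi : StrictMonoidal.
Proof.
refine (@MkStrictMonoidal AdjXiCat 𝟏 (@tensO C) xiTens
  (@tensOA C) (@tens1O C) (@tensO1 C) _ _ _ _ _).
- move=> X Y; rewrite /= xiTensE -tensH1; apply: xiPiE.
  by apply: xe_sym; apply: xe_in_tens.
- move=> X X' X'' Y Y' Y'' f' f g' g /=.
  rewrite -(xiReprK f') -(xiReprK f) -(xiReprK g') -(xiReprK g).
  by rewrite !(xiCompE, xiTensE); apply: xiPiE; apply: xe_tensM.
- move=> X X' Y Y' Z Z' f g h; rewrite !xiPi_idto /=.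
  rewrite -(xiReprK f) -(xiReprK g) -(xiReprK h).
  by rewrite !(xiCompE, xiTensE); apply: xiPiE; apply: xe_tensA.
- move=> X Y f; rewrite !xiPi_idto /= -(xiReprK f).
  by rewrite !(xiCompE, xiTensE); apply: xiPiE; apply: xe_tens1l.
- move=> X Y f; rewrite !xiPi_idto /= -(xiReprK f).
  by rewrite !(xiCompE, xiTensE); apply: xiPiE; apply: xe_tens1r.
Defined.
End AdjXi.

(* Main.v *)
From mathcomp Require Import all_boot.
Require Import Defs.

(** In the affinization, write ξ_X for ξ_{𝟏,X}.  Specializing the
formulas for ξ_{X,Y} ⊗ 1_Z and 1_X ⊗ ξ_{Y,Z} to ξ_{𝟏,X} gives
<<
  ξ_X ⊗ 1_Y = ξ_{Y,X} ∘ β_{X,Y}        1_Y ⊗ ξ_X = β_{Y,X}^{-1} ∘ ξ_{Y,X}.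
>>
The first one expresses every ξ_{X,Y} through the one-index family,
<<
  ξ_{X,Y} = (ξ_Y ⊗ 1_X) ∘ β_{Y,X}^{-1},
>>
so both categories are generated by C and the ξ_X, and the point is that the
two sets of relations imply one another.

From ξ_{X,Y} to ξ_X: comparing the two displayed formulas gives the relation
between ξ and β; composing 1_X ⊗ ξ_Y with ξ_X ⊗ 1_Y cancels the braidings and
leaves ξ_{Y,X} ∘ ξ_{X,Y} = ξ_{𝟏,X ⊗ Y}; naturality is that of ξ_{𝟏,X}.  This is
[xiEvalE], which yields the monoidal functor [adjXiToAff].

From ξ_X to ξ_{X,Y}: take the last formula as a definition, [xiXi].
Naturality is clear.  In the relation for ξ_{X,Y ⊗ Z} ([xiXi_tens]) the factor
ξ_Z ⊗ 1 has to cross an inverse braiding; the relation between ξ and β lets it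
through and turns β_{Y,Z}^{-1} into β_{Z,Y} ([abv_z_slide]), after which an
identity between braidings remains ([abv_hex_slide]).  The resulting functor is
monoidal because its values on ξ_{X,Y} ⊗ 1_Z and 1_X ⊗ ξ_{Y,Z} are the right
ones ([affToAdjXi_xiR], [affToAdjXi_xiL]), again by the hexagons.

Both composites fix C and the generators, hence are identities.  As in the
definitions, equations are checked on untyped arrows, where strict
associativity and unitality are plain equalities. *)

Set Implicit Arguments.
Unset Strict Implicit.
Unset Printing Implicit Defensive.

Local Open Scope cat_scope.

(** * Whiskering of untyped arrows *)

Section Whiskering.
Variable D : StrictMonoidal.
Implicit Types (f g : arr D) (X Y : D).

Lemma whiskerr_c f g X Y Y' Y'' : typed f Y Y' -> typed g Y' Y'' ->
  at2 (ac g f) (ai X) = ac (at2 g (ai X)) (at2 f (ai X)).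
Proof.
move=> tf tg; rewrite -(at_c tf tg (typed_i X) (typed_i X)).
by rewrite (ac1a (typed_i X)).
Qed.

Lemma whiskerl_c f g X Y Y' Y'' : typed f Y Y' -> typed g Y' Y'' ->
  at2 (ai X) (ac g f) = ac (at2 (ai X) g) (at2 (ai X) f).
Proof.
move=> tf tg; rewrite -(at_c (typed_i X) (typed_i X) tf tg).
by rewrite (ac1a (typed_i X)).
Qed.

Lemma whisker_lr f g X X' Y Y' : typed f X X' -> typed g Y Y' ->
  ac (at2 (ai X') g) (at2 f (ai Y)) = at2 f g.
Proof.
move=> tf tg; rewrite -(at_c tf (typed_i X') (typed_i Y) tg).
by rewrite (ac1a tf) (aca1 tg).
Qed.

Lemma whisker_rl f g X X' Y Y' : typed f X X' -> typed g Y Y' ->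
  ac (at2 f (ai Y')) (at2 (ai X) g) = at2 f g.
Proof.
move=> tf tg; rewrite -(at_c (typed_i X) tf tg (typed_i Y')).
by rewrite (aca1 tf) (ac1a tg).
Qed.
End Whiskering.

(** * The generators of the category obtained by adjoining the ξ_X *)

Section AffinizationIsAdjXi.
Variable C : BraidedStrictMonoidal.
Implicit Types X Y Z W : C.
Local Hint Resolve typed_pack typed_i typed_b typed_bv : typed_db.

Lemma abvX1 X : abv X 𝟏 = ai X.
Proof.
apply: (@ainv_uniq _ (ab X 𝟏) _ _ X X).
- by apply: typed_eq (typed_bv X 𝟏) _ _; rewrite ?tens1O ?tensO1.
- exact: typed_i.
- by rewrite abK tensO1.
- by rewrite abX1 (ac1a (typed_i _)).
Qed.

Definition xiIn : Functor C (AdjXi C).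
Proof.
refine (@MkFunctor C (AdjXi C) id (fun X Y f => xiPi (xIn f)) (fun _ => erefl) _).
by move=> X Y Z g f /=; rewrite xiCompE; apply: xiPiE; apply: xe_in_comp.
Defined.

Definition xi X : @Hom (AdjXi C) X X := xiPi (xXi X).
Definition xiV X : @Hom (AdjXi C) X X := xiPi (xXiV X).

Notation J := (amap xiIn).
Notation z X := (pack (xi X)).

Lemma typed_J a X Y : typed a X Y -> @typed (AdjXi C) (J a) X Y.
Proof. by move=> [f ->]; apply: (typed_pack (fH xiIn f)). Qed.

(** The monoidal structures of C and of [AdjXi C] share their objects; the
endpoints are written here with the product of C so that the associativity of
C alone normalizes all typing goals. *)
Lemma typed_tJ (a b : arr (AdjXi C)) X X' Y Y' :
  @typed (AdjXi C) a X X' -> @typed (AdjXi C) b Y Y' ->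
  @typed (AdjXi C) (at2 a b) (X ⊗ Y) (X' ⊗ Y').
Proof. exact: typed_t. Qed.

(* Solves typing goals, up to strict associativity and unitality. *)
Local Ltac ty :=
  lazymatch goal with
  | |- typed (ac _ _) _ _ => eapply typed_eq; [eapply typed_c; ty | ty | ty]
  | |- typed (@at2 (AdjXi C) _ _) _ _ =>
      eapply typed_eq; [eapply typed_tJ; ty | ty | ty]
  | |- typed (at2 _ _) _ _ => eapply typed_eq; [eapply typed_t; ty | ty | ty]
  | |- typed (amap _ _) _ _ =>
      eapply typed_eq; [first [eapply typed_J | eapply typed_I]; ty | ty | ty]
  | |- typed _ _ _ => eapply typed_eq; [eauto with typed_db nocore | ty | ty]
  | |- _ => try reflexivity; try (rewrite ?tensOA ?tens1O ?tensO1; reflexivity)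
  end.

(* Removes composition with identities. *)
Local Ltac sid := repeat first [erewrite ac1a by ty | erewrite aca1 by ty].

Lemma J_i X : J (ai X) = ai (X : AdjXi C). Proof. by []. Qed.

Lemma J_c b a X Y Z : typed a X Y -> typed b Y Z -> J (ac b a) = ac (J b) (J a).
Proof. exact: amap_c. Qed.

Lemma J_t a b : J (at2 a b) = at2 (J a) (J b).
Proof.
case: a b => [[X [X' f]]|] [[Y [Y' g]]|] //=; congr (pack _).
by rewrite /= xiTensE; apply: xiPiE; apply: xe_in_tens.
Qed.

(** Restates [at_i] with the object product of C, for the same reason as
[typed_tJ]. *)
Lemma at_iJ X Y : at2 (ai (X : AdjXi C)) (ai (Y : AdjXi C)) = ai (X ⊗ Y : AdjXi C).
Proof. exact: at_i. Qed.

Lemma xiK X : xiV X ∘ xi X = idm (X : AdjXi C).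
Proof. by rewrite /= xiCompE; apply: xiPiE; apply: xe_xiK. Qed.
Lemma xiVK X : xi X ∘ xiV X = idm (X : AdjXi C).
Proof. by rewrite /= xiCompE; apply: xiPiE; apply: xe_xiVK. Qed.

Lemma z_nat f X Y : typed f X Y -> ac (z Y) (J f) = ac (J f) (z X).
Proof.
move=> [{}f ->]; rewrite -[LHS]pack_comp -[RHS]pack_comp; congr (pack _).
by rewrite /= !xiCompE; apply: xiPiE; apply: xe_xi_nat.
Qed.

Lemma z_tens X Y : z (X ⊗ Y) = at2 (z X) (z Y).
Proof.
rewrite -pack_tens; congr (pack _).
by rewrite /= xiTensE; apply: xiPiE; apply: xe_xi_tens.
Qed.

Lemma z_braid X Y :
  ac (J (abv Y X)) (at2 (z X) (ai (Y : AdjXi C)))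
  = ac (at2 (ai (Y : AdjXi C)) (z X)) (J (ab X Y)).
Proof.
rewrite -[LHS]pack_comp -[RHS]pack_comp; congr (pack _).
by rewrite /xi /= !(xiCompE, xiTensE); apply: xiPiE; apply: xe_xi_braid.
Qed.

(** * The functor out of the affinization *)

(** The value forced on ξ_{X,Y}: in the affinization,
ξ_Y ⊗ 1_X = ξ_{X,Y} ∘ β_{Y,X}. *)
Definition xiXi X Y : @Hom (AdjXi C) (X ⊗ Y) (Y ⊗ X) :=
  (xi Y ⊠ idm (X : AdjXi C)) ∘ fH xiIn (braidV Y X).
Definition xiXiV X Y : @Hom (AdjXi C) (Y ⊗ X) (X ⊗ Y) :=
  fH xiIn (braid Y X) ∘ (xiV Y ⊠ idm (X : AdjXi C)).

Lemma pack_xiXi X Y :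
  pack (xiXi X Y) = ac (at2 (z Y) (ai (X : AdjXi C))) (J (abv Y X)).
Proof. by rewrite pack_comp. Qed.

Lemma xiXiK X Y : xiXiV X Y ∘ xiXi X Y = idm (X ⊗ Y : AdjXi C).
Proof.
rewrite /xiXi /xiXiV -compA (compA (xiV Y ⊠ _)) -tensHM xiK comp1f tensH1.
by rewrite comp1f -[LHS](fHM xiIn) braidVK fH1.
Qed.
Lemma xiXiVK X Y : xiXi X Y ∘ xiXiV X Y = idm (Y ⊗ X : AdjXi C).
Proof.
rewrite /xiXi /xiXiV -compA (compA (fH xiIn (braidV _ _))).
rewrite -[fH xiIn (braidV _ _) ∘ _](fHM xiIn) braidK fH1.
by rewrite comp1f -tensHM xiVK comp1f tensH1.
Qed.

Lemma pack_J X Y (f : Hom X Y) : pack (fH xiIn f) = J (pack f).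
Proof. by []. Qed.

(** By the hexagons, the last two factors are β_{Z ⊗ Y,X}^{-1} composed with
1_X ⊗ β_{Z,Y}^{-1}; naturality moves the latter to the left, where it cancels
against β_{Z,Y} ⊗ 1_X. *)
Lemma abv_hex_slide X Y Z :
  ac (at2 (ab Z Y) (ai X)) (ac (at2 (ai Z) (abv Y X)) (abv Z (X ⊗ Y)))
  = abv (Y ⊗ Z) X.
Proof.
rewrite abv_hexr (acA (at2 (ai Z) _)) -abv_hexl.
rewrite (@abv_nat _ _ _ (Y ⊗ Z) (Z ⊗ Y) X X); try by ty.
rewrite acA -(@at_cr _ _ _ _ (Y ⊗ Z) (Z ⊗ Y) (Y ⊗ Z)); try by ty.
by rewrite abVK at_i; sid.
Qed.

(** The braiding is natural for the morphisms of C only, not for ξ_Z.  So ξ_Z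
is moved past β_{Y,Z}^{-1} by [z_braid], at the price of replacing the latter
by β_{Z,Y}; past β_{Y,X}^{-1} it moves by interchange. *)
Lemma abv_z_slide X Y Z :
  ac (J (abv Y (Z ⊗ X))) (at2 (z Z) (ai (X ⊗ Y : AdjXi C)))
  = ac (at2 (ai (Y : AdjXi C)) (at2 (z Z) (ai (X : AdjXi C))))
       (ac (J (at2 (ab Z Y) (ai X))) (J (at2 (ai Z) (abv Y X)))).
Proof.
rewrite abv_hexr (@J_c _ _ (Z ⊗ X ⊗ Y) (Z ⊗ Y ⊗ X) (Y ⊗ Z ⊗ X)); try by ty.
rewrite !J_t !J_i -acA.
rewrite (@whisker_lr (AdjXi C) (z Z) _ Z Z (X ⊗ Y) (Y ⊗ X)); try by ty.
rewrite -(@whisker_rl (AdjXi C) (z Z) _ Z Z (X ⊗ Y) (Y ⊗ X)); try by ty.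
rewrite -at_iJ !atA !acA.
rewrite -(@whiskerr_c (AdjXi C) _ _ X (Z ⊗ Y) (Z ⊗ Y) (Y ⊗ Z)); try by ty.
rewrite z_braid.
by rewrite (@whiskerr_c (AdjXi C) _ _ X (Z ⊗ Y) (Y ⊗ Z) (Y ⊗ Z)) //; ty.
Qed.

Lemma xiXi_tens X Y Z :
  xiXi X (Y ⊗ Z) = fH xiIn (asc Y Z X) ∘ (xiXi (Z ⊗ X) Y ∘ (fH xiIn (asc Z X Y) ∘
      (xiXi (X ⊗ Y) Z ∘ fH xiIn (asc X Y Z)))).
Proof.
apply: pack_inj.
rewrite !(pack_xiXi, pack_comp (C := AdjXi C), pack_J, pack_idto, J_i); sid.
rewrite -!acA (acA (J (abv Y _))) abv_z_slide -!acA.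
rewrite -(@J_c _ _ (X ⊗ Y ⊗ Z) (Z ⊗ X ⊗ Y) (Z ⊗ Y ⊗ X)); try by ty.
rewrite -(@J_c _ _ (X ⊗ Y ⊗ Z) (Z ⊗ Y ⊗ X) (Y ⊗ Z ⊗ X)); try by ty.
rewrite abv_hex_slide z_tens acA -at_iJ !atA.
rewrite -(@whiskerr_c (AdjXi C) _ _ X (Y ⊗ Z) (Y ⊗ Z) (Y ⊗ Z)); try by ty.
by rewrite (@whisker_rl (AdjXi C) (z Y) _ Y Y Z Z) //; ty.
Qed.

Lemma xiXi_nat X1 X2 Y1 Y2 (f : Hom Y1 Y2) (g : Hom X1 X2) :
  xiXi X2 Y2 ∘ fH xiIn (g ⊠ f) = fH xiIn (f ⊠ g) ∘ xiXi X1 Y1.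
Proof.
apply: pack_inj; rewrite !(pack_xiXi, pack_comp (C := AdjXi C), pack_J, pack_tens).
have := typed_pack f; have := typed_pack g; move: (pack f) (pack g) => {}f {}g tg tf.
rewrite -acA -(@J_c _ _ (X1 ⊗ Y1) (X2 ⊗ Y2) (Y2 ⊗ X2)); try by ty.
rewrite (abv_nat tf tg) (@J_c _ _ (X1 ⊗ Y1) (Y1 ⊗ X1) (Y2 ⊗ X2)); try by ty.
rewrite !acA J_t; congr (ac _ _).
rewrite -(@at_c (AdjXi C) _ _ _ _ Y1 Y2 Y2 X1 X2 X2); try by ty.
rewrite -(@at_c (AdjXi C) _ _ _ _ Y1 Y1 Y2 X1 X1 X2); try by ty.
by rewrite (z_nat tf); sid.
Qed.

Definition affToAdjXiF : Functor (Aff C) (AdjXi C) :=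
  @affLift C (AdjXi C) xiIn xiXi xiXiV xiXiK xiXiVK xiXi_tens xiXi_nat.

Lemma affToAdjXi_in X Y (f : Hom X Y) :
  fH affToAdjXiF (fH (affIn C) f) = fH xiIn f.
Proof. exact: affLift_in. Qed.
Lemma affToAdjXi_xi X Y : fH affToAdjXiF (affXi X Y) = xiXi X Y.
Proof. exact: affLift_xi. Qed.

Definition adjTensFr (Z : AdjXi C) : Functor (AdjXi C) (AdjXi C).
Proof.
refine (@MkFunctor (AdjXi C) (AdjXi C) (fun X => X ⊗ Z) (fun X Y f => f ⊠ idm Z) _ _).
- by move=> X; rewrite tensH1.
- by move=> X Y W g f; rewrite -tensHM comp1f.
Defined.

Definition adjTensFl (Z : AdjXi C) : Functor (AdjXi C) (AdjXi C).
Proof.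
refine (@MkFunctor (AdjXi C) (AdjXi C) (fun X => Z ⊗ X) (fun X Y f => idm Z ⊠ f) _ _).
- by move=> X; rewrite tensH1.
- by move=> X Y W g f; rewrite -tensHM comp1f.
Defined.

Lemma xiIn_tens X X' Y Y' (f : Hom X X') (g : Hom Y Y') :
  fH xiIn (f ⊠ g) = fH xiIn f ⊠ fH xiIn g.
Proof. by apply: pack_inj; rewrite pack_tens !pack_J pack_tens J_t. Qed.

Lemma amapF_I a : amap affToAdjXiF (amap (affIn C) a) = J a.
Proof.
case: a => [[X [Y f]]|] //.
by rewrite -[LHS]/(pack (fH affToAdjXiF (fH (affIn C) f))) affToAdjXi_in.
Qed.
Lemma amapF_x X Y : amap affToAdjXiF (pack (affXi X Y)) = pack (xiXi X Y).
Proof. by rewrite -pack_fH affToAdjXi_xi. Qed.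

(** Splitting β_{Y,X ⊗ Z}^{-1} by a hexagon, the factor 1_X ⊗ β_{Y,Z}^{-1}
cancels the braiding in ξ_{X,Y} ⊗ 1_Z. *)
Lemma affToAdjXi_xiR X Y Z :
  fH affToAdjXiF (affXiR X Y Z) = xiXi X Y ⊠ idm (Z : AdjXi C).
Proof.
apply: pack_inj; rewrite pack_fH pack_xiR.
rewrite (@amap_c (AffCat C) _ _ _ _ (X ⊗ Y ⊗ Z) (X ⊗ Z ⊗ Y) (Y ⊗ X ⊗ Z)); try by ty.
rewrite amapF_I amapF_x pack_tens !pack_xiXi pack_idm.
rewrite abv_hexr -acA -(@J_c _ _ (X ⊗ Y ⊗ Z) (X ⊗ Z ⊗ Y) (Y ⊗ X ⊗ Z)); try by ty.
rewrite -acA -(@whiskerl_c C _ _ X (Y ⊗ Z) (Z ⊗ Y) (Y ⊗ Z)); try by ty.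
rewrite abK !at_i; sid.
rewrite (@whiskerr_c (AdjXi C) _ _ Z (X ⊗ Y) (Y ⊗ X) (Y ⊗ X)); try by ty.
by rewrite -at_iJ atA J_t J_i.
Qed.

(** Here the braiding to cancel stands left of ξ_Z, so [z_braid] first brings
it next to β_{Z,X}^{-1}, as the braiding β_{Z,X}. *)
Lemma affToAdjXi_xiL X Y Z :
  fH affToAdjXiF (affXiL X Y Z) = idm (X : AdjXi C) ⊠ xiXi Y Z.
Proof.
apply: pack_inj; rewrite pack_fH pack_xiL.
rewrite (@amap_c (AffCat C) _ _ _ _ (X ⊗ Y ⊗ Z) (Z ⊗ X ⊗ Y) (X ⊗ Z ⊗ Y)); try by ty.
rewrite amapF_I amapF_x pack_tens !pack_xiXi pack_idm.
rewrite -at_iJ atA J_t J_i acA.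
rewrite -(@whiskerr_c (AdjXi C) _ _ Y (Z ⊗ X) (Z ⊗ X) (X ⊗ Z)); try by ty.
rewrite z_braid (@whiskerr_c (AdjXi C) _ _ Y (Z ⊗ X) (X ⊗ Z) (X ⊗ Z)); try by ty.
rewrite -acA -(J_t (ab Z X) (ai Y)).
rewrite -(@J_c _ _ (X ⊗ Y ⊗ Z) (Z ⊗ X ⊗ Y) (X ⊗ Z ⊗ Y)); try by ty.
rewrite abv_hexr acA -(@whiskerr_c C _ _ Y (X ⊗ Z) (Z ⊗ X) (X ⊗ Z)); try by ty.
rewrite abVK at_i; sid.
rewrite (@whiskerl_c (AdjXi C) _ _ X (Y ⊗ Z) (Z ⊗ Y) (Z ⊗ Y)); try by ty.
by rewrite J_t !J_i atA.
Qed.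

(** Both sides are functors of f, so the values on morphisms of C and on the
ξ_{X,Y} determine them. *)
Lemma affToAdjXi_R Z X X' (f : @Hom (Aff C) X X') :
  fH affToAdjXiF (fH (affR Z) f) = fH affToAdjXiF f ⊠ idm (Z : AdjXi C).
Proof.
rewrite -[LHS]comp1f -[RHS]compf1.
apply: (@affNat C (AdjXi C) (compF affToAdjXiF (affR Z))
  (compF (adjTensFr Z) affToAdjXiF)
  (fun W => idm (W ⊗ Z : AdjXi C))) => {X X' f} [X X' f|X Y];
  rewrite comp1f compf1.
- rewrite -[LHS]/(fH affToAdjXiF (fH (affR Z) _)) affR_in affToAdjXi_in.
  by rewrite -[RHS]/(fH affToAdjXiF _ ⊠ _) affToAdjXi_in xiIn_tens.
- rewrite -[LHS]/(fH affToAdjXiF (fH (affR Z) _)) affR_xi affToAdjXi_xiR.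
  by rewrite -[RHS]/(fH affToAdjXiF _ ⊠ _) affToAdjXi_xi.
Qed.

Lemma affToAdjXi_L Z X X' (f : @Hom (Aff C) X X') :
  fH affToAdjXiF (fH (affL Z) f) = idm (Z : AdjXi C) ⊠ fH affToAdjXiF f.
Proof.
rewrite -[LHS]comp1f -[RHS]compf1.
apply: (@affNat C (AdjXi C) (compF affToAdjXiF (affL Z))
  (compF (adjTensFl Z) affToAdjXiF)
  (fun W => idm (Z ⊗ W : AdjXi C))) => {X X' f} [X X' f|X Y];
  rewrite comp1f compf1.
- rewrite -[LHS]/(fH affToAdjXiF (fH (affL Z) _)) affL_in affToAdjXi_in.
  by rewrite -[RHS]/(_ ⊠ fH affToAdjXiF _) affToAdjXi_in xiIn_tens.
- rewrite -[LHS]/(fH affToAdjXiF (fH (affL Z) _)) affL_xi affToAdjXi_xiL.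
  by rewrite -[RHS]/(_ ⊠ fH affToAdjXiF _) affToAdjXi_xi.
Qed.

Definition affToAdjXi : SMFunctor (Aff C) (AdjXi C).
Proof.
refine (@MkSMFunctor (Aff C) (AdjXi C) affToAdjXiF erefl (fun _ _ => erefl) _).
move=> X X' Y Y' f g; rewrite comp1f compf1.
rewrite -[f ⊠ g]/(fH (affR Y') f ∘ fH (affL X) g) fHM affToAdjXi_R affToAdjXi_L.
by rewrite -tensHM comp1f compf1.
Defined.

(** * The functor into the affinization *)

(** The morphism ξ_X = ξ_{𝟏,X}, whose endpoints 𝟏 ⊗ X and X ⊗ 𝟏 are only
propositionally equal to X. *)
Definition affXi1 X : @Hom (AffCat C) X X :=
  fH (affIn C) (idto (tensO1 X)) ∘ affXi 𝟏 X
    ∘ fH (affIn C) (idto (esym (tens1O X))).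
Definition affXi1V X : @Hom (AffCat C) X X :=
  fH (affIn C) (idto (tens1O X)) ∘ affXiV 𝟏 X
    ∘ fH (affIn C) (idto (esym (tensO1 X))).

Fixpoint xiEval X Y (t : xiTerm X Y) : @Hom (Aff C) X Y :=
  match t in xiTerm X Y return @Hom (Aff C) X Y with
  | xIn X Y f => fH (affIn C) f
  | xXi X => affXi1 X
  | xXiV X => affXi1V X
  | xComp X Y Z t s => xiEval t ∘ xiEval s
  | xTens X X' Y Y' t s => tensH (s := Aff C) (xiEval t) (xiEval s)
  end.

Lemma pack_affXi1 X : pack (affXi1 X) = pack (affXi 𝟏 X).
Proof.
rewrite !pack_comp !pack_in !pack_idto !I_i.
by rewrite (@aca1 (AffCat C) _ X X) ?(@ac1a (AffCat C) _ X (X ⊗ 𝟏)) //; ty.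
Qed.

Lemma pack_affXi1V X : pack (affXi1V X) = pack (affXiV 𝟏 X).
Proof.
rewrite !pack_comp !pack_in !pack_idto !I_i.
by rewrite (@aca1 (AffCat C) _ X X) ?(@ac1a (AffCat C) _ X (𝟏 ⊗ X)) //; ty.
Qed.

Lemma idto_aff X Y (e : X = Y) : idto (C := Aff C) e = fH (affIn C) (idto e).
Proof. by case: Y / e. Qed.

Lemma affXi1K X : affXi1V X ∘ affXi1 X = idm (X : AffCat C).
Proof.
apply: pack_inj; rewrite pack_comp pack_affXi1 pack_affXi1V -pack_comp affXiK.
by rewrite !pack_idm tens1O.
Qed.
Lemma affXi1VK X : affXi1 X ∘ affXi1V X = idm (X : AffCat C).
Proof.
apply: pack_inj; rewrite pack_comp pack_affXi1 pack_affXi1V -pack_comp affXiVK.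
by rewrite !pack_idm tensO1.
Qed.

Lemma affXi1_nat X Y (f : Hom X Y) :
  affXi1 Y ∘ fH (affIn C) f = fH (affIn C) f ∘ affXi1 X.
Proof.
apply: pack_inj; rewrite !(pack_affXi1, pack_comp, pack_in).
rewrite -{1}(at1a (pack f)) (@x_nat _ _ _ 𝟏 𝟏 X Y); try by ty.
by rewrite ata1.
Qed.

(** The formula for the tensor product of ξ_{𝟏,X} with 1_Y on the right. *)
Lemma affXi1_tens1 X Y :
  pack (tensH (s := Aff C) (affXi1 X) (idm (Y : Aff C)))
  = ac (pack (affXi Y X)) (amap (affIn C) (ab X Y)).
Proof.
rewrite pack_tens pack_idm pack_affXi1 -pack_idm -pack_tens Aff_xi_tens1.
rewrite pack_xiR at1a.
by rewrite tens1O.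
Qed.

(** The formula for the tensor product of ξ_{𝟏,X} with 1_Y on the left. *)
Lemma affXi1_1tens X Y :
  pack (tensH (s := Aff C) (idm (Y : Aff C)) (affXi1 X))
  = ac (amap (affIn C) (abv Y X)) (pack (affXi Y X)).
Proof.
rewrite pack_tens pack_idm pack_affXi1 -pack_idm -pack_tens Aff_1tens_xi.
by rewrite pack_xiL ata1 tensO1.
Qed.

(** In (ξ_X ⊗ 1_Y) ∘ (1_X ⊗ ξ_Y) the inner braidings cancel and leave
ξ_{Y,X} ∘ ξ_{X,Y}, which is ξ_{𝟏,X ⊗ Y} by the defining relation of the
affinization. *)
Lemma affXi1_tens X Y :
  affXi1 (X ⊗ Y) = tensH (s := Aff C) (affXi1 X) (affXi1 Y).
Proof.
apply: pack_inj; rewrite pack_affXi1.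
rewrite [RHS](pack_tens (C := Aff C)) -(@whisker_rl (Aff C) _ _ X X Y Y);
  try exact: typed_pack.
have := affXi1_1tens Y X; have := affXi1_tens1 X Y.
rewrite !(pack_tens (C := Aff C)) pack_idm x_tens => -> ->.
rewrite tensO1 tens1O -acA (acA (amap _ _)) -I_c abVK I_i.
by rewrite (@ac1a (AffCat C) _ (X ⊗ Y) (Y ⊗ X)) //; ty.
Qed.

Lemma affXi1_braid X Y :
  fH (affIn C) (braidV Y X) ∘ tensH (s := Aff C) (affXi1 X) (idm (Y : Aff C))
  = tensH (s := Aff C) (idm (Y : Aff C)) (affXi1 X) ∘ fH (affIn C) (braid X Y).
Proof.
apply: pack_inj.
rewrite [LHS](pack_comp (C := AffCat C)) [RHS](pack_comp (C := AffCat C)).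
rewrite affXi1_tens1 affXi1_1tens.
by rewrite -acA.
Qed.

Lemma xiEvalE X Y (t s : xiTerm X Y) : xiEq t s -> xiEval t = xiEval s.
Proof.
elim=> {X Y t s}; cbn [xiEval].
- by [].
- by move=> *; apply: esym.
- by move=> X Y t s u _ -> _ ->.
- by move=> X Y Z t t' s s' _ -> _ ->.
- by move=> X X' Y Y' t t' s s' _ -> _ ->.
- by move=> *; rewrite compA.
- by move=> *; rewrite fH1 comp1f.
- by move=> *; rewrite fH1 compf1.
- by move=> *; apply: tensHM.
- by move=> X X' Y Y' Z Z' t s u; rewrite -!idto_aff; apply: (tensHA (s := Aff C)).
- by move=> X Y t; rewrite fH1 -!idto_aff; apply: (tens1H (s := Aff C)).
- by move=> X Y t; rewrite fH1 -!idto_aff; apply: (tensH1r (s := Aff C)).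
- by move=> *; rewrite fHM.
- by move=> *; rewrite Aff_in.
- by move=> X; rewrite fH1; apply: affXi1K.
- by move=> X; rewrite fH1; apply: affXi1VK.
- by move=> X Y; rewrite fH1; apply: affXi1_braid.
- by move=> X Y; apply: affXi1_tens.
- by move=> X Y f; apply: affXi1_nat.
Qed.

Definition adjXiToAffF : Functor (AdjXi C) (Aff C).
Proof.
refine (@MkFunctor (AdjXi C) (Aff C) id (fun X Y f => xiEval (xiRepr f)) _ _).
- by move=> X; rewrite (xiEvalE (xiReprP _)); apply: (fH1 (affIn C)).
- by move=> X Y Z g f; rewrite (xiEvalE (xiReprP _)).
Defined.

Lemma adjXiToAff_pi X Y (t : xiTerm X Y) : fH adjXiToAffF (xiPi t) = xiEval t.
Proof. by rewrite /= (xiEvalE (xiReprP _)). Qed.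

Definition adjXiToAff : SMFunctor (AdjXi C) (Aff C).
Proof.
refine (@MkSMFunctor (AdjXi C) (Aff C) adjXiToAffF erefl (fun _ _ => erefl) _).
move=> X X' Y Y' f g; rewrite comp1f compf1.
by rewrite -(xiReprK f) -(xiReprK g) -[_ ⊠ _]/(xiTens _ _) xiTensE !adjXiToAff_pi.
Defined.

(** * The two functors are inverse to each other *)

Lemma adjXiToAffK X Y (f : @Hom (Aff C) X Y) :
  fH adjXiToAff (fH affToAdjXi f) = f.
Proof.
rewrite -[LHS]comp1f -[RHS]compf1.
apply: (@affNat C (AffCat C) (compF adjXiToAff affToAdjXi) (idF _)
  (fun W => idm (W : AffCat C))) => {X Y f} [X Y f|X Y];
  rewrite comp1f compf1.
- rewrite -[LHS]/(fH adjXiToAffF (fH affToAdjXiF _)) affToAdjXi_in.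
  exact: adjXiToAff_pi.
- rewrite -[LHS]/(fH adjXiToAffF (fH affToAdjXiF _)) affToAdjXi_xi.
  transitivity (tensH (s := Aff C) (affXi1 Y) (idm (X : Aff C))
    ∘ fH (affIn C) (braidV Y X)).
    rewrite /xiXi fHM; congr (_ ∘ _); last exact: adjXiToAff_pi.
    by rewrite -[_ ⊠ _]/(xiTens _ _) xiTensE adjXiToAff_pi.
  apply: pack_inj; rewrite [LHS](pack_comp (C := AffCat C)) affXi1_tens1.
  rewrite (pack_in (braidV Y X)) -acA -I_c abVK I_i.
  by rewrite (@aca1 (AffCat C) _ (X ⊗ Y) (Y ⊗ X)) //; ty.
Qed.

Lemma affToAdjXi_xi1 X : fH affToAdjXi (affXi1 X) = xi X.
Proof.
apply: pack_inj; rewrite pack_fH pack_affXi1 amapF_x pack_xiXi abvX1 J_i.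
rewrite (ata1 (C := AdjXi C)).
by sid.
Qed.

(** A functor preserves inverses, and ξ_X has only one. *)
Lemma affToAdjXi_xi1V X : fH affToAdjXi (affXi1V X) = xiV X.
Proof.
rewrite -[LHS]comp1f -(xiK X) -affToAdjXi_xi1 -compA -fHM affXi1VK.
by rewrite fH1 compf1.
Qed.

Lemma affToAdjXiK X Y (f : @Hom (AdjXi C) X Y) :
  fH affToAdjXi (fH adjXiToAff f) = f.
Proof.
rewrite -(xiReprK f) [fH adjXiToAff _]adjXiToAff_pi.
elim: {f}(xiRepr f) => {X Y} [X Y f|X|X|X Y Z t IHt s IHs|X X' Y Y' t IHt s IHs];
 cbn [xiEval].
- exact: affToAdjXi_in.
- exact: affToAdjXi_xi1.
- exact: affToAdjXi_xi1V.
- by rewrite fHM IHt IHs; apply: xiCompE.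
- have := smFH affToAdjXi (xiEval t) (xiEval s).
  by rewrite comp1f compf1 => ->; rewrite IHt IHs; apply: xiTensE.
Qed.

End AffinizationIsAdjXi.

Theorem theorem2p6 (C : BraidedStrictMonoidal) : isoSM (Aff C) (AdjXi C).
Proof.
exists (affToAdjXi C), (adjXiToAff C); split.
- exists (fun X => erefl) => X Y f; rewrite comp1f compf1; exact: adjXiToAffK.
- exists (fun X => erefl) => X Y f; rewrite comp1f compf1; exact: affToAdjXiK.
Qed.
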